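(* Let $n=m$, let $\mathbf{B}$ be nonsingular, and assume that the noise assumptions (A1) and (A2) of the context hold. Fix $\alpha\in(0,1)$ and run the same-sample stochastic extragradient iteration (SEG) of the context from $(\mathbf{x}_0,\mathbf{y}_0)$ with constant step size $\eta=\hat\eta_{\mathbf{M}}(\alpha)$. Then for all integers $K\ge 1$ the averaged iterates $$\overline{\mathbf{x}}_K=\frac{1}{K+1}\sum_{t=0}^K\mathbf{x}_t,\qquad \overline{\mathbf{y}}_K=\frac{1}{K+1}\sum_{t=0}^K\mathbf{y}_t$$ satisfy $$\mathbb{E}\big[\|\overline{\mathbf{x}}_K\|^2+\|\overline{\mathbf{y}}_K\|^2\big]\le \tau_1\cdot\frac{\|\mathbf{x}_0\|^2+\|\mathbf{y}_0\|^2}{(K+1)^2}+\tau_2\cdot\frac{\sigma_{\mathbf{g}}^2}{K+1},$$ where $$\tau_1=\frac{16+8\kappa_\zeta}{(1-\alpha)\,\hat\eta_{\mathbf{M}}(\alpha)^2\,\lambda_{\min}(\mathbf{B}\mathbf{B}^\top)},\qquad \tau_2=\frac{18+12\kappa_\zeta}{(1-\alpha)\,\lambda_{\min}(\mathbf{B}\mathbf{B}^\top)},\qquad \kappa_\zeta=\frac{\sigma_{\mathbf{B}}^2+\hat\eta_{\mathbf{M}}(\alpha)^2\sigma_{\mathbf{B},2}^2}{\lambda_{\min}(\mathbf{M})\wedge\lambda_{\min}(\widehat{\mathbf{M}})}.$$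
   Context: Notation: $a\wedge b=\min(a,b)$, $a\vee b=\max(a,b)$; $\lambda_{\max},\lambda_{\min}$ are the largest and smallest eigenvalues of a real symmetric matrix; $\|\cdot\|$ is the Euclidean norm, $\|\cdot\|_{op}$ the operator norm. Data: a random triple $(\mathbf{B}_\xi,\mathbf{g}^{\mathbf{x}}_\xi,\mathbf{g}^{\mathbf{y}}_\xi)$ with values in $\mathbb{R}^{n\times m}\times\mathbb{R}^n\times\mathbb{R}^m$; $\mathbb{E}_\xi$ is expectation over it. For $t\ge1$, $(\mathbf{B}_{\xi,t},\mathbf{g}^{\mathbf{x}}_{\xi,t},\mathbf{g}^{\mathbf{y}}_{\xi,t})$ are i.i.d. copies; $(\mathbf{x}_0,\mathbf{y}_0)\in\mathbb{R}^n\times\mathbb{R}^m$ is deterministic. Put $\mathbf{B}=\mathbb{E}_\xi[\mathbf{B}_\xi]$, $\mathbf{M}_\xi=\mathbf{B}_\xi\mathbf{B}_\xi^\top$, $\widehat{\mathbf{M}}_\xi=\mathbf{B}_\xi^\top\mathbf{B}_\xi$, $\mathbf{M}=\mathbb{E}_\xi\mathbf{M}_\xi$, $\widehat{\mathbf{M}}=\mathbb{E}_\xi\widehat{\mathbf{M}}_\xi$. (A1) $\lambda_{\max}(\mathbf{B}^\top\mathbf{B})>0$, $\lambda_{\min}(\mathbf{M})\wedge\lambda_{\min}(\widehat{\mathbf{M}})>0$, and $\sigma_{\mathbf{B}},\sigma_{\mathbf{B},2}\in[0,\infty)$ are such that $\|\mathbb{E}_\xi[(\mathbf{B}_\xi-\mathbf{B})^\top(\mathbf{B}_\xi-\mathbf{B})]\|_{op}\le\sigma_{\mathbf{B}}^2$,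 $\|\mathbb{E}_\xi[(\mathbf{B}_\xi-\mathbf{B})(\mathbf{B}_\xi-\mathbf{B})^\top]\|_{op}\le\sigma_{\mathbf{B}}^2$, $\|\mathbb{E}_\xi[(\widehat{\mathbf{M}}_\xi-\widehat{\mathbf{M}})^2]\|_{op}\le\sigma_{\mathbf{B},2}^2$, $\|\mathbb{E}_\xi[(\mathbf{M}_\xi-\mathbf{M})^2]\|_{op}\le\sigma_{\mathbf{B},2}^2$. (A2) $\sigma_{\mathbf{g}}\in[0,\infty)$ is such that $\mathbb{E}_\xi[\|\mathbf{g}^{\mathbf{x}}_\xi\|^2+\|\mathbf{g}^{\mathbf{y}}_\xi\|^2]\le\sigma_{\mathbf{g}}^2$; $\mathbb{E}_\xi[\mathbf{g}^{\mathbf{x}}_\xi]=\mathbf{0}$, $\mathbb{E}_\xi[\mathbf{g}^{\mathbf{y}}_\xi]=\mathbf{0}$; and $\mathbf{B}_\xi$ is independent of $[\mathbf{g}^{\mathbf{x}}_\xi;\mathbf{g}^{\mathbf{y}}_\xi]$. (SEG) With constant step size $\eta$, for $t\ge1$: $\mathbf{x}_{t-1/2}=\mathbf{x}_{t-1}-\eta[\mathbf{B}_{\xi,t}\mathbf{y}_{t-1}+\mathbf{g}^{\mathbf{x}}_{\xi,t}]$, $\mathbf{y}_{t-1/2}=\mathbf{y}_{t-1}+\eta[\mathbf{B}_{\xi,t}^\top\mathbf{x}_{t-1}+\mathbf{g}^{\mathbf{y}}_{\xi,t}]$, $\mathbf{x}_t=\mathbf{x}_{t-1}-\eta[\mathbf{B}_{\xi,t}\mathbf{y}_{t-1/2}+\mathbf{g}^{\mathbf{x}}_{\xi,t}]$,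 $\mathbf{y}_t=\mathbf{y}_{t-1}+\eta[\mathbf{B}_{\xi,t}^\top\mathbf{x}_{t-1/2}+\mathbf{g}^{\mathbf{y}}_{\xi,t}]$. Step size: $\eta_{\mathbf{M}}=1/\sqrt{\rho_1\vee\rho_2}$ with $\rho_1=\lambda_{\max}(\mathbf{M}^{-1/2}[\mathbb{E}_\xi\mathbf{M}_\xi^2]\mathbf{M}^{-1/2})$, $\rho_2=\lambda_{\max}(\widehat{\mathbf{M}}^{-1/2}[\mathbb{E}_\xi\widehat{\mathbf{M}}_\xi^2]\widehat{\mathbf{M}}^{-1/2})$, and $$\hat\eta_{\mathbf{M}}(\alpha)=\frac{\eta_{\mathbf{M}}}{\sqrt2}\wedge\frac{\alpha\lambda_{\min}(\mathbf{B}\mathbf{B}^\top)}{2\sigma_{\mathbf{B}}^2\sqrt{\lambda_{\max}(\mathbf{B}^\top\mathbf{B})}},$$ where the second term is read as $+\infty$ if $\sigma_{\mathbf{B}}=0$. *)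

(* Defs.v *)
From HB Require Import structures.
From mathcomp Require Import all_boot all_order all_algebra finmap.
From mathcomp Require Import all_classical all_reals all_analysis.
Set Implicit Arguments.
Unset Strict Implicit.
Unset Printing Implicit Defensive.
Import Order.TTheory GRing.Theory Num.Theory.
Local Open Scope classical_set_scope.
Local Open Scope ring_scope.

Section linear_algebra.
Context {R : realType}.

(* Euclidean norm; the library norm on matrices is the max norm. *)
Definition enorm n (x : 'cV[R]_n) : R := Num.sqrt (\sum_i x i 0 ^+ 2).

Definition opnorm m n (A : 'M[R]_(m, n)) : R :=
  sup [set enorm (A *m x) | x in [set x : 'cV[R]_n | enorm x <= 1]].

(* For symmetric A of positive size the set of (real) eigenvalues is finite and
   nonempty, so that sup and inf are a maximum and a minimum. *)
Definition lambda_max n (A : 'M[R]_n) : R :=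
  sup [set a | eigenvalue A a].

Definition lambda_min n (A : 'M[R]_n) : R :=
  inf [set a | eigenvalue A a].

Definition psdmx n (A : 'M[R]_n) : Prop :=
  A^T = A /\ forall x : 'cV[R]_n, 0 <= (x^T *m A *m x) 0 0.

(* The positive semidefinite square root of A: it exists and is unique when A
   is positive semidefinite; the value is 0 when there is none. *)
Definition sqrtmx n (A : 'M[R]_n) : 'M[R]_n :=
  xget 0 [set S : 'M[R]_n | psdmx S /\ S *m S = A].

End linear_algebra.

(* Matrices carry the product sigma-algebra of their entries. *)
Definition measure_matrix_display : measure_display -> measure_display.
Proof. by []. Qed.

Section measurable_matrix.
Context d (T : measurableType d) (m n : nat).

Definition mx_cylinders : set_system 'M[T]_(m, n) :=
  \bigcup_(ij in [set: 'I_m * 'I_n])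
    preimage_set_system [set: 'M[T]_(m, n)]
      (fun A : 'M[T]_(m, n) => A ij.1 ij.2) measurable.

Let mx_set0 : <<s mx_cylinders >> set0.
Proof. exact: sigma_algebra0. Qed.

Let mx_setC A : <<s mx_cylinders >> A -> <<s mx_cylinders >> (~` A).
Proof. exact: sigma_algebraC. Qed.

Let mx_bigcup (F : (set 'M[T]_(m, n))^nat) :
  (forall i, <<s mx_cylinders >> (F i)) -> <<s mx_cylinders >> (\bigcup_i F i).
Proof. exact: sigma_algebra_bigcup. Qed.

HB.instance Definition _ := @isMeasurable.Build (measure_matrix_display d)
  'M[T]_(m, n) <<s mx_cylinders >> mx_set0 mx_setC mx_bigcup.

End measurable_matrix.

Section probability.
Context {R : realType}.

Definition mx_integrable d (T : measurableType d) (P : probability T R) m n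
    (X : T -> 'M[R]_(m, n)) : Prop :=
  forall i j, P.-integrable [set: T] (fun w => (X w i j)%:E).

(* Entrywise expectation, meaningful when mx_integrable P X. *)
Definition mx_expectation d (T : measurableType d) (P : probability T R) m n
    (X : T -> 'M[R]_(m, n)) : 'M[R]_(m, n) :=
  \matrix_(i, j) fine ('E_P[fun w => X w i j])%E.

Definition independent2 d (T : measurableType d) (P : probability T R)
    d1 (T1 : measurableType d1) d2 (T2 : measurableType d2)
    (X : T -> T1) (Y : T -> T2) : Prop :=
  forall A C, measurable A -> measurable C ->
    (P (X @^-1` A `&` Y @^-1` C) = P (X @^-1` A) * P (Y @^-1` C))%E.

Definition mutually_independent d (T : measurableType d) (P : probability T R)
    (I : choiceType) d' (T' : measurableType d') (X : I -> T -> T') : Prop :=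
  forall (J : {fset I}) (A : I -> set T'), (forall i, measurable (A i)) ->
    P (\bigcap_(i in [set` J]) X i @^-1` A i) =
    (\prod_(i <- J) P (X i @^-1` A i))%E.

(* X is a family of i.i.d. copies of xi, where xi may live on another
   probability space. *)
Definition iid_copies d0 (T0 : measurableType d0) (P0 : probability T0 R)
    d (T : measurableType d) (P : probability T R) d' (T' : measurableType d')
    (I : choiceType) (xi : {RV P0 >-> T'}) (X : I -> {RV P >-> T'}) : Prop :=
  mutually_independent P X /\
  forall i A, measurable A -> distribution P (X i) A = distribution P0 xi A.

End probability.

(* Samples (B_xi, g^x_xi, g^y_xi). *)
Notation sample R n m := ('M[R]_(n, m) * 'cV[R]_n * 'cV[R]_m)%type.

Section seg.
Context {R : realType} {n m : nat}.

Definition sB (z : sample R n m) : 'M[R]_(n, m) := z.1.1.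
Definition sgx (z : sample R n m) : 'cV[R]_n := z.1.2.
Definition sgy (z : sample R n m) : 'cV[R]_m := z.2.

Definition seg_step (eta : R) (z : sample R n m) (xy : 'cV[R]_n * 'cV[R]_m) :
    'cV[R]_n * 'cV[R]_m :=
  let: (x, y) := xy in
  let x_half := x - eta *: (sB z *m y + sgx z) in
  let y_half := y + eta *: ((sB z)^T *m x + sgy z) in
  (x - eta *: (sB z *m y_half + sgx z),
   y + eta *: ((sB z)^T *m x_half + sgy z)).

(* Step t.+1 uses the sample z t.+1; z 0 is never used. *)
Fixpoint seg (eta : R) (x0 : 'cV[R]_n) (y0 : 'cV[R]_m)
    (z : nat -> sample R n m) (t : nat) : 'cV[R]_n * 'cV[R]_m :=
  if t is t'.+1 then seg_step eta (z t'.+1) (seg eta x0 y0 z t')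
  else (x0, y0).

Definition seg_avg_x eta x0 y0 z (K : nat) : 'cV[R]_n :=
  K.+1%:R^-1 *: \sum_(0 <= t < K.+1) (seg eta x0 y0 z t).1.

Definition seg_avg_y eta x0 y0 z (K : nat) : 'cV[R]_m :=
  K.+1%:R^-1 *: \sum_(0 <= t < K.+1) (seg eta x0 y0 z t).2.

End seg.

Section noise.
Context {R : realType} {n m : nat} {d : measure_display} {T : measurableType d}.
Variables (P : probability T R) (xi : {RV P >-> sample R n m}).

Definition Bxi (w : T) : 'M[R]_(n, m) := sB (xi w).
Definition gxxi (w : T) : 'cV[R]_n := sgx (xi w).
Definition gyxi (w : T) : 'cV[R]_m := sgy (xi w).
Definition Mxi (w : T) : 'M[R]_n := Bxi w *m (Bxi w)^T.
Definition Mhxi (w : T) : 'M[R]_m := (Bxi w)^T *m Bxi w.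

Definition Bmean : 'M[R]_(n, m) := mx_expectation P Bxi.
Definition Mmean : 'M[R]_n := mx_expectation P Mxi.
Definition Mhmean : 'M[R]_m := mx_expectation P Mhxi.

Definition lambda_min_M : R := Num.min (lambda_min Mmean) (lambda_min Mhmean).

(* The existence of E[X] is part of the bound on its operator norm. *)
Definition mean_op_le k (X : T -> 'M[R]_k) (c : R) : Prop :=
  mx_integrable P X /\ opnorm (mx_expectation P X) <= c.

Definition bilinear_noise (sigB sigB2 : R) : Prop :=
  [/\ [/\ mx_integrable P Bxi, mx_integrable P Mxi & mx_integrable P Mhxi],
      0 < lambda_max (Bmean^T *m Bmean) /\ 0 < lambda_min_M,
      0 <= sigB /\ 0 <= sigB2,
      mean_op_le (fun w => (Bxi w - Bmean)^T *m (Bxi w - Bmean)) (sigB ^+ 2) /\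
      mean_op_le (fun w => (Bxi w - Bmean) *m (Bxi w - Bmean)^T) (sigB ^+ 2)
    & mean_op_le (fun w => (Mhxi w - Mhmean) *m (Mhxi w - Mhmean))
        (sigB2 ^+ 2) /\
      mean_op_le (fun w => (Mxi w - Mmean) *m (Mxi w - Mmean)) (sigB2 ^+ 2)].

(* Integrability of the two means follows from the second moment bound. *)
Definition intercept_noise (sigg : R) : Prop :=
  [/\ 0 <= sigg,
      ('E_P[fun w => (enorm (gxxi w) ^+ 2 + enorm (gyxi w) ^+ 2)%R]
         <= (sigg ^+ 2)%:E)%E,
      mx_expectation P gxxi = 0,
      mx_expectation P gyxi = 0
    & independent2 P Bxi (fun w => (gxxi w, gyxi w))].

Definition rho1 : R :=
  lambda_max (invmx (sqrtmx Mmean) *m mx_expectation P (fun w => Mxi w *m Mxi w)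
                *m invmx (sqrtmx Mmean)).

Definition rho2 : R :=
  lambda_max (invmx (sqrtmx Mhmean)
                *m mx_expectation P (fun w => Mhxi w *m Mhxi w)
                *m invmx (sqrtmx Mhmean)).

Definition eta_M : R := (Num.sqrt (Num.max rho1 rho2))^-1.

(* The second term of the minimum is read as +oo when sigB = 0. *)
Definition eta_hat (sigB alpha : R) : R :=
  if sigB == 0 then eta_M / Num.sqrt 2
  else Num.min (eta_M / Num.sqrt 2)
    (alpha * lambda_min (Bmean *m Bmean^T) /
       (2 * sigB ^+ 2 * Num.sqrt (lambda_max (Bmean^T *m Bmean)))).

Definition kappa_zeta (sigB sigB2 alpha : R) : R :=
  (sigB ^+ 2 + eta_hat sigB alpha ^+ 2 * sigB2 ^+ 2) / lambda_min_M.

Definition tau1 (sigB sigB2 alpha : R) : R :=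
  (16 + 8 * kappa_zeta sigB sigB2 alpha) /
  ((1 - alpha) * eta_hat sigB alpha ^+ 2 * lambda_min (Bmean *m Bmean^T)).

Definition tau2 (sigB sigB2 alpha : R) : R :=
  (18 + 12 * kappa_zeta sigB sigB2 alpha) /
  ((1 - alpha) * lambda_min (Bmean *m Bmean^T)).

End noise.

(* Main.v *)
From HB Require Import structures.
Require Import Defs.
From mathcomp Require Import all_boot all_order all_algebra finmap.
From mathcomp Require Import all_classical all_reals all_analysis.
From mathcomp Require Import measurable_realfun.
From mathcomp Require Import ring lra.
Set Implicit Arguments.
Unset Strict Implicit.
Unset Printing Implicit Defensive.
Import Order.TTheory GRing.Theory Num.Theory.
Import numFieldNormedType.Exports.
Local Open Scope classical_set_scope.
Local Open Scope ring_scope.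

(** Stack the primal and dual variables into z = (x, y). The game becomes the linear
    equation J z = 0 for the random skew matrix J = ((0, B), (- B^T, 0)), and one step reads
        z+ = z - eta J z - eta^2 S z - eta (h - eta J h),   S = J^T J,
    where h is the additive noise. Write Jm and Sm for the means of J and S; then Sm is block
    diagonal, and its blocks are the means of B B^T and B^T B.

    Let b and c accumulate the increments (J - Jm) z + eta (S - Sm) z and
    h - eta J h. Summing the steps, with Sum the sum of z_0, ..., z_K,
        (Jm + eta Sm) Sum = (z_0 - z_(K+1)) / eta - b - c
    ([telescope_mean_field]). Therefore
        |(Jm + eta Sm) Sum|^2 <= 2 |b|^2 + 4 |c|^2 + 8 (|z_0|^2 + |z_(K+1)|^2) / eta^2.

    The mean field can be inverted. Indeed Sm is Jm^T Jm plus the covariance of J, and Jm is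
    skew, so the cross term of |Jm v + eta Sm v|^2 only sees the covariance, which is at
    most sigB^2. The second bound on the step size makes it at most a fraction alpha of |Jm v|^2,
    whence |(Jm + eta Sm) v|^2 >= (1 - alpha) mu |v|^2, where mu is the least eigenvalue of
    Bm Bm^T and Bm is the mean of B ([mean_field_lower_bound]).

    All expectations needed on the right-hand side are controlled at once by
        V(z, b, c) = 2 |b|^2 + 4 |c|^2 + a |z|^2,   a = (8 + 8 kappa) / eta^2.
    As J is skew, the mean of |z+|^2 is |z|^2 - eta^2 z . Sm z + eta^4 E |S z|^2 plus noise;
    the first bound on the step size gives eta^2 E |S z|^2 <= (1/2) z . Sm z, so a share of
    a |z|^2 is lost, and this pays for the growth of 2 |b|^2. What remains is the additive
    noise, so that the mean of V increases by at most (18 + 12 kappa) sigg^2 per step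
    ([lyapunov_drift], [saddle_drift]). Iterating along the chain ([chain_drift]) and adding 8 |z_0|^2 / eta^2
    to V(z_0, 0, 0) = a |z_0|^2 gives the two constants of the statement.

    Only integrals of nonnegative functions occur for the iterates: the state at time t is
    independent of the next sample ([chain_indep]), so the theorem of Tonelli reduces each
    step to an estimate for a fixed state, where the moments of a single sample suffice. *)

(** * Euclidean geometry and spectral theory of real symmetric matrices *)

Section dot_product.
Context {R : realType}.

Definition dot n (u v : 'cV[R]_n) : R := (u^T *m v) 0 0.

Lemma dotE n (u v : 'cV[R]_n) : dot u v = \sum_i u i 0 * v i 0.
Proof. by rewrite /dot mxE; apply: eq_bigr => i _; rewrite mxE. Qed.

Lemma dotC n (u v : 'cV[R]_n) : dot u v = dot v u.
Proof. by rewrite !dotE; apply: eq_bigr => i _; rewrite mulrC. Qed.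

Lemma dotDr n (u v w : 'cV[R]_n) : dot u (v + w) = dot u v + dot u w.
Proof. by rewrite /dot mulmxDr mxE. Qed.

Lemma dotDl n (u v w : 'cV[R]_n) : dot (v + w) u = dot v u + dot w u.
Proof. by rewrite dotC dotDr ![dot u _]dotC. Qed.

Lemma dotZr n a (u v : 'cV[R]_n) : dot u (a *: v) = a * dot u v.
Proof. by rewrite /dot -scalemxAr mxE. Qed.

Lemma dotZl n a (u v : 'cV[R]_n) : dot (a *: u) v = a * dot u v.
Proof. by rewrite dotC dotZr dotC. Qed.

Lemma dotNr n (u v : 'cV[R]_n) : dot u (- v) = - dot u v.
Proof. by rewrite -scaleN1r dotZr mulN1r. Qed.

Lemma dotNl n (u v : 'cV[R]_n) : dot (- u) v = - dot u v.
Proof. by rewrite dotC dotNr dotC. Qed.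

Lemma dotBr n (u v w : 'cV[R]_n) : dot u (v - w) = dot u v - dot u w.
Proof. by rewrite dotDr dotNr. Qed.

Lemma dot0r n (u : 'cV[R]_n) : dot u 0 = 0.
Proof. by rewrite /dot mulmx0 mxE. Qed.

Definition dot_lin := (dotDr, dotDl, dotNr, dotNl, dotZr, dotZl).

Lemma dot_mulmx m n (A : 'M[R]_(m, n)) u v : dot u (A *m v) = dot (A^T *m u) v.
Proof. by rewrite /dot trmx_mul trmxK mulmxA. Qed.

Lemma dot_ge0 n (u : 'cV[R]_n) : 0 <= dot u u.
Proof. by rewrite dotE; apply: sumr_ge0 => i _; rewrite -expr2 sqr_ge0. Qed.

Lemma dot_eq0 n (u : 'cV[R]_n) : dot u u = 0 -> u = 0.
Proof.
rewrite dotE => /eqP; rewrite psumr_eq0; last first.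
  by move=> i _; rewrite -expr2 sqr_ge0.
move=> /allP u0; apply/matrixP => i j; rewrite ord1 mxE.
by have := u0 i (mem_index_enum _); rewrite -expr2 sqrf_eq0 => /eqP.
Qed.

Lemma enormE n (u : 'cV[R]_n) : enorm u ^+ 2 = dot u u.
Proof.
rewrite /enorm sqr_sqrtr; last by apply: sumr_ge0 => i _; rewrite sqr_ge0.
by rewrite dotE; apply: eq_bigr => i _; rewrite expr2.
Qed.

Lemma enorm_ge0 n (u : 'cV[R]_n) : 0 <= enorm u.
Proof. exact: sqrtr_ge0. Qed.

Lemma dot_CauchySchwarz n (u v : 'cV[R]_n) : dot u v ^+ 2 <= dot u u * dot v v.
Proof.
have [v0|v0] := eqVneq (dot v v) 0.
  by rewrite (dot_eq0 v0) !dot0r expr0n mulr0.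
have vp : 0 < dot v v by rewrite lt_def v0 dot_ge0.
have := dot_ge0 (dot v v *: u - dot u v *: v).
rewrite !dot_lin (dotC v u) => h.
rewrite -subr_ge0 -(pmulr_rge0 _ vp).
by apply: le_trans h _; rewrite le_eqVlt; apply/orP; left; apply/eqP; ring.
Qed.

Lemma dot_young n (c : R) (u v : 'cV[R]_n) : 0 < c ->
  - (c * dot u u + c^-1 * dot v v) <= 2 * dot u v.
Proof.
move=> c0; have := dot_ge0 (c *: u + v).
rewrite !dot_lin (dotC v u) => h.
rewrite -(ler_pM2l c0) mulrN mulrDr mulrA -expr2 [c * (c^-1 * _)]mulrA.
rewrite divff ?gt_eqF// mul1r; lra.
Qed.

Lemma dot_sumD n (u v : 'cV[R]_n) :
  dot (u + v) (u + v) <= 2 * dot u u + 2 * dot v v.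
Proof.
have := dot_ge0 (u - v); rewrite !dot_lin (dotC v u); lra.
Qed.

End dot_product.

Section spectral.
Context {R : realType}.

Lemma continuous_sum (T : topologicalType) n (f : 'I_n -> T -> R) :
  (forall i, continuous (f i)) -> continuous (fun x => \sum_i f i x).
Proof.
by move=> cf; apply: continuous_big => // x; exact: add_continuous.
Qed.

Lemma continuous_mul (T : topologicalType) (f g : T -> R) :
  continuous f -> continuous g -> continuous (fun x => f x * g x).
Proof. by move=> cf cg x; exact: (cvgM (cf x) (cg x)). Qed.

(** Maximise the quadratic form of A over the unit vectors orthogonal to the rows of U, a
    compact set. If the maximum a is attained at u, then a |v|^2 - v . A v is nonnegative
    on that orthogonal complement and vanishes at u; being a minimum there, its derivative
    at u in the direction w = a u - A u, which is 2 |w|^2, has to vanish. The complement is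
    stable under A because the rows of U are eigenvectors, so w does lie in it. *)
Lemma exists_orthogonal_eigenvector n (A : 'M[R]_n) k (U : 'M[R]_(k, n)) (D : 'rV[R]_k) :
  A^T = A -> (k < n)%N -> U *m A = diag_mx D *m U ->
  exists (u : 'cV[R]_n) (a : R), [/\ dot u u = 1, U *m u = 0 & A *m u = a *: u].
Proof.
move=> As kn UA.
pose f (v : 'rV[R]_n) : R := dot v^T (A *m v^T).
pose K := [set v : 'rV[R]_n | U *m v^T = 0 /\ dot v^T v^T = 1].
have coord i : continuous (fun v : 'rV[R]_n => v 0 i) by exact: coord_continuous.
have cf : continuous f.
  have -> : f = (fun v => \sum_i v 0 i * \sum_j A i j * v 0 j).
    apply/funext => v; rewrite /f dotE; apply: eq_bigr => i _; rewrite !mxE.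
    by congr (_ * _); apply: eq_bigr => j _; rewrite mxE.
  apply: continuous_sum => i; apply: continuous_mul => //.
  apply: continuous_sum => j; apply: continuous_mul => //; exact: cst_continuous.
have K0 : K !=set0.
  have : kermx U^T != 0.
    rewrite -mxrank_eq0 mxrank_ker subn_eq0 -ltnNge.
    by rewrite (leq_ltn_trans _ kn)// mxrank_tr rank_leq_row.
  move/rowV0Pn => [v /sub_kermxP vU v0].
  have vv : 0 < dot v^T v^T.
    rewrite lt_def dot_ge0 andbT; apply: contra v0 => /eqP/dot_eq0 h.
    by rewrite -(trmxK v) h trmx0.
  exists ((Num.sqrt (dot v^T v^T))^-1 *: v); split.
    by rewrite linearZ /= -scalemxAr -[U]trmxK -trmx_mul vU trmx0 scaler0.
  rewrite linearZ /= !dot_lin mulrA -expr2 exprVn sqr_sqrtr ?ltW//.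
  by rewrite mulVf ?gt_eqF.
have cK : compact K.
  apply: bounded_closed_compact.
    exists 1; split; first exact: num_real.
    move=> M M1 v [_ v1] /=; apply: le_trans (ltW M1).
    rewrite /Num.norm/= mx_normrE; apply/bigmax_leP; split => //= -[i j] _ /=.
    rewrite [i]ord1 -(@ler_pXn2r _ 2) ?nnegrE// expr1n real_normK ?num_real// -v1 dotE.
    rewrite (bigD1 j)//= mxE -expr2 lerDl.
    by apply: sumr_ge0 => l _; rewrite mxE -expr2 sqr_ge0.
  have -> : K = (\bigcap_(i in [set: 'I_k]) (fun v : 'rV[R]_n =>
      \sum_j U i j * v 0 j) @^-1` [set 0]) `&`
      (fun v : 'rV[R]_n => \sum_j v 0 j * v 0 j) @^-1` [set 1].
    have UvE v i : (U *m v^T) i 0 = \sum_j U i j * v 0 j.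
      by rewrite mxE; apply: eq_bigr => j _; rewrite mxE.
    have vvE v : dot v^T v^T = \sum_j v 0 j * v 0 j.
      by rewrite dotE; apply: eq_bigr => j _; rewrite !mxE.
    apply/seteqP; split => [v [Uv v1]|v [Uv v1]]; split.
    - by move=> i _ /=; rewrite -UvE Uv mxE.
    - by rewrite /= -vvE.
    - by apply/matrixP => i j; rewrite ord1 UvE [RHS]mxE; exact: Uv.
    - by rewrite vvE.
  apply: closedI; [apply: closed_bigI => i _|]; apply: preimage_closed;
    try exact: closed_eq; move=> v _.
  - apply: continuous_sum => j; apply: continuous_mul => //; exact: cst_continuous.
  - by apply: continuous_sum => j; exact: continuous_mul.
have [c] : exists2 c, c \in K & forall t, t \in K -> f t <= f c.
  by apply: EVT_max_rV => //; apply: continuous_subspaceT.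
rewrite inE => -[Uc c1] cmax.
pose a := f c; pose u := c^T.
have fcE w : U *m w = 0 -> dot w (A *m w) <= a * dot w w.
  move=> Uw; have [w0|w0] := eqVneq (dot w w) 0.
    by rewrite (dot_eq0 w0) mulmx0 !dot0r mulr0.
  have ww : 0 < dot w w by rewrite lt_def w0 dot_ge0.
  have s0 : 0 < Num.sqrt (dot w w) by rewrite sqrtr_gt0.
  have := cmax ((Num.sqrt (dot w w))^-1 *: w^T).
  rewrite inE /f linearZ /= trmxK -scalemxAr => h.
  have : K ((Num.sqrt (dot w w))^-1 *: w^T).
    split; rewrite linearZ /= trmxK -?scalemxAr ?Uw ?scaler0//.
    by rewrite !dot_lin mulrA -expr2 exprVn sqr_sqrtr ?ltW// mulVf ?gt_eqF.
  move=> /h; rewrite -/(f c) -/a !dot_lin mulrA -expr2 exprVn.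
  by rewrite (sqr_sqrtr (ltW ww)) ler_pdivrMl// [dot w w * _]mulrC.
exists u, a; split => //.
have [w wE] : exists w, w = a *: u - A *m u by exists (a *: u - A *m u).
have UAu : U *m (A *m u) = 0 by rewrite mulmxA UA -mulmxA Uc mulmx0.
have Uw : U *m w = 0 by rewrite wE mulmxBr -scalemxAr Uc scaler0 UAu subr0.
(* Nonnegativity of the form at u + t w. *)
have key t : 0 <= t ^+ 2 * (a * dot w w - dot w (A *m w)) + 2 * t * dot w w.
  have := fcE (u + t *: w).
  rewrite mulmxDr Uc -scalemxAr Uw scaler0 addr0 => /(_ erefl).
  rewrite mulmxDr -scalemxAr !dot_lin.
  have e1 : dot u (A *m u) = a by [].
  have e2 : dot u (A *m w) = dot w (A *m u) by rewrite dot_mulmx As dotC.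
  have e3 : a * dot w u = dot w w + dot w (A *m u).
    by rewrite -dotDr -dotZr; congr (dot w _); rewrite wE subrK.
  have e4 : dot u u = 1 by [].
  rewrite e2 (dotC u w) e1 e4 => h.
  have e5 : a * (t * dot w u) = t * (dot w w + dot w (A *m u)).
    by rewrite -e3; ring.
  move: h; rewrite !mulrDr e5; lra.
have w0 : dot w w = 0.
  apply/eqP; rewrite eq_le dot_ge0 andbT leNgt; apply/negP => wp.
  set q := a * dot w w - dot w (A *m w) in key.
  have q0 : 0 <= q by rewrite subr_ge0 fcE.
  (* A small negative t makes the linear term dominate the quadratic one. *)
  pose t := - dot w w / (q + 1).
  have q1 : 0 < q + 1 by lra.
  have := key t.
  have tq : t * (q + 1) = - dot w w by rewrite /t mulrVK ?unitfE ?gt_eqF.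
  have t0 : t < 0 by rewrite /t mulNr oppr_lt0 divr_gt0.
  rewrite expr2 -mulrA -[2 * t]mulrC -[t * 2 * _]mulrA -mulrDr.
  rewrite nmulr_rge0// => h.
  have : t * q = - dot w w - t by rewrite -tq; ring.
  by lra.
by apply/eqP; rewrite eq_sym -subr_eq0; rewrite -wE; apply/eqP/dot_eq0.
Qed.

Lemma orthonormal_eigenrows n (A : 'M[R]_n) k : A^T = A -> (k <= n)%N ->
  exists (U : 'M[R]_(k, n)) (D : 'rV[R]_k),
    U *m U^T = 1%:M /\ U *m A = diag_mx D *m U.
Proof.
move=> As; elim: k => [_|k IH kn].
  by exists 0, 0; split; apply/matrixP => -[].
have [U [D [UU UA]]] := IH (ltnW kn).
have [u [a [u1 Uu Au]]] := exists_orthogonal_eigenvector As kn UA.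
have oV : col_mx u^T U *m (col_mx u^T U)^T = 1%:M.
  rewrite tr_col_mx mul_col_row trmxK UU Uu -[u^T *m U^T]trmxK trmx_mul !trmxK Uu.
  rewrite trmx0 scalar_mx_block; congr block_mx.
  by apply/matrixP => i j; rewrite !ord1 [RHS]mxE; exact: u1.
have VA : col_mx u^T U *m A = diag_mx (row_mx a%:M D) *m col_mx u^T U.
  rewrite mul_col_mx UA diag_mx_row mul_block_col !mul0mx addr0 add0r.
  congr col_mx.
  rewrite -[u^T *m A]trmxK trmx_mul trmxK As Au linearZ /=.
  rewrite -mul_scalar_mx; congr (_ *m _).
  by apply/matrixP => i j; rewrite !ord1 !mxE eqxx mulr1n.
by exists (col_mx u^T U), (row_mx a%:M D).
Qed.

Lemma real_spectral n (A : 'M[R]_n) : A^T = A ->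
  exists (U : 'M[R]_n) (D : 'rV[R]_n),
    U^T *m U = 1%:M /\ A = U^T *m diag_mx D *m U.
Proof.
move=> As; have [U [D [UU UA]]] := orthonormal_eigenrows As (leqnn n).
exists U, D; have UU' := mulmx1C UU; split => //.
by rewrite -mulmxA -UA mulmxA UU' mul1mx.
Qed.

Lemma quadratic_diag n (U : 'M[R]_n) (D : 'rV[R]_n) x :
  dot x (U^T *m diag_mx D *m U *m x) = \sum_i D 0 i * (U *m x) i 0 ^+ 2.
Proof.
rewrite -!mulmxA dot_mulmx trmxK dotE; apply: eq_bigr => i _.
by rewrite mul_diag_mx [in X in _ * X]mxE expr2 mulrCA.
Qed.

Lemma dot_orthogonal n (U : 'M[R]_n) x : U^T *m U = 1%:M ->
  dot x x = \sum_i (U *m x) i 0 ^+ 2.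
Proof.
move=> UU; rewrite -[x in dot _ x]mul1mx -UU -mulmxA dot_mulmx trmxK dotE.
by apply: eq_bigr => i _; rewrite expr2.
Qed.

Lemma eigenvalue_quadratic n (A : 'M[R]_n) a : eigenvalue A a ->
  exists2 x : 'cV[R]_n, 0 < dot x x & dot x (A *m x) = a * dot x x.
Proof.
move=> /eigenvalueP[v vA v0]; exists v^T.
  rewrite lt_def dot_ge0 andbT; apply: contra v0 => /eqP/dot_eq0 h.
  by rewrite -[v]trmxK h trmx0.
by rewrite dot_mulmx -trmx_mul vA linearZ /= dotZl.
Qed.

Lemma eigenvalue_diag n (U : 'M[R]_n) (D : 'rV[R]_n) i : U^T *m U = 1%:M ->
  eigenvalue (U^T *m diag_mx D *m U) (D 0 i).
Proof.
move=> UU; have UU' := mulmx1C UU; apply/eigenvalueP; exists (row i U).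
  by rewrite !mulmxA -row_mul UU' row1 -rowE row_diag_mx -scalemxAl -rowE.
apply/eqP => h; have := congr1 (fun v => (v *m U^T) 0 i) h.
rewrite mul0mx -row_mul UU' !mxE eqxx => /eqP.
by rewrite oner_eq0.
Qed.

(** The largest diagonal entry of a diagonalisation is an eigenvalue and bounds the
    quadratic form, hence bounds every eigenvalue: the supremum is this entry. *)
Lemma lambda_maxP n (A : 'M[R]_n) : (0 < n)%N -> A^T = A ->
  eigenvalue A (lambda_max A) /\
  forall x, dot x (A *m x) <= lambda_max A * dot x x.
Proof.
move=> n0 As; have [U [D [UU AE]]] := real_spectral As.
case: (@arg_maxP _ _ _ (Ordinal n0) xpredT (fun i => D 0 i) isT) => i _ imax.
have q x : dot x (A *m x) <= D 0 i * dot x x.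
  rewrite {1}AE quadratic_diag (dot_orthogonal x UU) mulr_sumr.
  by apply: ler_sum => j _; rewrite ler_wpM2r ?sqr_ge0//; exact: imax.
have ev : eigenvalue A (D 0 i) by rewrite {1}AE; exact: eigenvalue_diag.
have ub : ubound [set a | eigenvalue A a] (D 0 i).
  move=> a /= /eigenvalue_quadratic[x xp e].
  by rewrite -(ler_pM2r xp) -e q.
suff -> : lambda_max A = D 0 i by [].
apply/eqP; rewrite eq_le /lambda_max; apply/andP; split.
  by apply: ge_sup => //; exists (D 0 i).
by apply: ub_le_sup => //; exists (D 0 i).
Qed.

Lemma lambda_minP n (A : 'M[R]_n) : (0 < n)%N -> A^T = A ->
  eigenvalue A (lambda_min A) /\
  forall x, lambda_min A * dot x x <= dot x (A *m x).
Proof.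
move=> n0 As; have [U [D [UU AE]]] := real_spectral As.
case: (@arg_minP _ _ _ (Ordinal n0) xpredT (fun i => D 0 i) isT) => i _ imin.
have q x : D 0 i * dot x x <= dot x (A *m x).
  rewrite {1}AE quadratic_diag (dot_orthogonal x UU) mulr_sumr.
  by apply: ler_sum => j _; rewrite ler_wpM2r ?sqr_ge0//; exact: imin.
have ev : eigenvalue A (D 0 i) by rewrite {1}AE; exact: eigenvalue_diag.
have lb : lbound [set a | eigenvalue A a] (D 0 i).
  move=> a /= /eigenvalue_quadratic[x xp e].
  by rewrite -(ler_pM2r xp) -e q.
suff -> : lambda_min A = D 0 i by [].
apply/eqP; rewrite eq_le /lambda_min; apply/andP; split.
  by apply: ge_inf => //; exists (D 0 i).
by apply: lb_le_inf => //; exists (D 0 i).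
Qed.

(** Diagonalise and take the square roots of the eigenvalues; this exhibits a positive
    semidefinite root, which is all that the choice operator needs. *)
Lemma sqrtmxP n (A : 'M[R]_n) : psdmx A ->
  (sqrtmx A)^T = sqrtmx A /\ sqrtmx A *m sqrtmx A = A.
Proof.
move=> [As Apsd]; have [U [D [UU AE]]] := real_spectral As.
have UU' := mulmx1C UU.
have D0 i : 0 <= D 0 i.
  have /eigenvalue_quadratic[x xp e] := eigenvalue_diag D i UU.
  rewrite -(pmulr_lge0 _ xp) -e -AE.
  by have := Apsd x; rewrite /dot mulmxA.
pose E := map_mx Num.sqrt D : 'rV[R]_n.
suff : exists S : 'M[R]_n, psdmx S /\ S *m S = A.
  by rewrite /sqrtmx => /(@xgetPex _ 0)[[sym _] sq].
exists (U^T *m diag_mx E *m U); split; last first.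
  rewrite -!mulmxA [U *m (U^T *m _)]mulmxA UU' mul1mx !mulmxA.
  rewrite -[U^T *m _ *m diag_mx E]mulmxA mulmx_diag AE; congr (_ *m diag_mx _ *m _).
  by apply/rowP => i; rewrite !mxE -expr2 sqr_sqrtr.
split; first by rewrite !trmx_mul trmxK tr_diag_mx mulmxA.
move=> x; rewrite -mulmxA -/(dot _ _) quadratic_diag.
by apply: sumr_ge0 => i _; rewrite mulr_ge0 ?sqr_ge0// mxE sqrtr_ge0.
Qed.

(** Cauchy-Schwarz and homogeneity; the supremum defining the operator norm is meaningful
    because the Frobenius norm bounds the set. *)
Lemma opnorm_quadratic n (A : 'M[R]_n) c x : opnorm A <= c ->
  dot x (A *m x) <= c * dot x x.
Proof.
move=> Ac; have [x0|x0] := eqVneq (dot x x) 0.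
  by rewrite (dot_eq0 x0) mulmx0 !dot0r mulr0.
have xp : 0 < dot x x by rewrite lt_def x0 dot_ge0.
have [M HM] : exists M, forall y : 'cV[R]_n, dot (A *m y) (A *m y) <= M * dot y y.
  exists (\sum_i dot (row i A)^T (row i A)^T) => y.
  rewrite dotE mulr_suml; apply: ler_sum => i _.
  rewrite -expr2.
  have -> : (A *m y) i 0 = dot (row i A)^T y.
    by rewrite /dot trmxK -row_mul [RHS]mxE.
  exact: dot_CauchySchwarz.
have hub : has_ubound [set enorm (A *m y) | y in [set y : 'cV[R]_n | enorm y <= 1]].
  exists (Num.max M 1) => _ [y /= y1 <-].
  rewrite -(@ler_pXn2r _ 2) ?nnegrE ?enorm_ge0 ?le_max ?ler01 ?orbT//.
  have y1' : dot y y <= 1 by rewrite -enormE expr_le1 ?enorm_ge0.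
  rewrite enormE; apply: le_trans (HM y) _.
  have m1 : 1 <= Num.max M 1 by rewrite le_max lexx orbT.
  have mM : M <= Num.max M 1 by rewrite le_max lexx.
  have := dot_ge0 y; nra.
pose s := Num.sqrt (dot x x).
have s0 : 0 < s by rewrite sqrtr_gt0.
have ss : s ^+ 2 = dot x x by rewrite sqr_sqrtr ?ltW.
have Ay : enorm (A *m (s^-1 *: x)) <= c.
  apply: le_trans Ac; apply: ub_le_sup => //; exists (s^-1 *: x) => //=.
  rewrite -(@ler_pXn2r _ 2) ?nnegrE ?enorm_ge0// enormE !dot_lin -ss.
  by rewrite expr1n mulrA -expr2 exprVn mulVf// expf_neq0 ?gt_eqF.
have c0 : 0 <= c by apply: le_trans Ay; exact: enorm_ge0.
have Axx : dot (A *m x) (A *m x) <= c ^+ 2 * dot x x.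
  have : enorm (A *m (s^-1 *: x)) ^+ 2 <= c ^+ 2.
    by rewrite ler_pXn2r ?nnegrE ?enorm_ge0.
  rewrite enormE -scalemxAr !dot_lin mulrA -expr2 exprVn ss.
  by rewrite ler_pdivrMl// [_ * c ^+ 2]mulrC.
have := dot_CauchySchwarz x (A *m x) => CS.
have : dot x (A *m x) ^+ 2 <= (c * dot x x) ^+ 2.
  apply: le_trans CS _; rewrite exprMn mulrC [dot x x ^+ 2]expr2 mulrA.
  by rewrite ler_wpM2r// ltW.
move=> h; apply: le_trans (ler_norm _) _.
have cx0 : 0 <= c * dot x x by rewrite mulr_ge0// ltW.
by rewrite -(@ler_pXn2r _ 2) ?nnegrE// real_normK ?num_real.
Qed.

End spectral.

(** * Independence and Markov chains *)

Section independence.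
Context {R : realType}.

(** Rectangles are stable under intersection and generate the product sigma-algebra. *)
Lemma eq_measure_rectangles d1 d2 (T1 : measurableType d1) (T2 : measurableType d2)
    (m1 m2 : {measure set (T1 * T2) -> \bar R}) :
  (forall A C, measurable A -> measurable C -> m1 (A `*` C) = m2 (A `*` C)) ->
  (m1 setT < +oo)%E ->
  forall E, measurable E -> m1 E = m2 E.
Proof.
move=> m12 fin E mE.
pose G : set (set (T1 * T2)) :=
  [set C | exists A, measurable A /\ exists B, measurable B /\ C = A `*` B].
apply: (measure_unique G (fun=> setT)) => //.
- rewrite measurable_prod_measurableType //; congr (<<s _ >>).
  rewrite predeqE; split => [[A mA [B mB <-]]|[A [mA [B [mB ->]]]]].
    by exists A; split => //; exists B.
  by exists A => //; exists B.
- move=> /= _ _ [X1 [mX1 [X2 [mX2 ->]]]] [Y1 [mY1 [Y2 [mY2 ->]]]].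
  rewrite -setXI; exists (X1 `&` Y1); split; first exact: measurableI.
  by exists (X2 `&` Y2); split => //; exact: measurableI.
- move=> _; exists setT; split => //; exists setT; split => //.
  by rewrite setXTT.
- by rewrite bigcup_const.
- by move=> _ [A [mA [B [mB ->]]]]; exact: m12.
Qed.

Lemma measurable_section_integral d' (T' : measurableType d')
    (P' : probability T' R) d1 d2 (T1 : measurableType d1)
    (T2 : measurableType d2) (Y : T' -> T2) (f : T1 * T2 -> \bar R) :
  measurable_fun setT Y -> measurable_fun setT f -> (forall z, 0 <= f z)%E ->
  measurable_fun setT (fun x => \int[P']_w f (x, Y w))%E.
Proof.
move=> mY mf f0.
pose Y_ : {mfun T' >-> T2} := HB.pack Y (isMeasurableFun.Build _ _ _ _ _ mY).
have -> : (fun x => \int[P']_w f (x, Y w))%E = fubini_F (distribution P' Y_) f.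
  apply/funext => x; rewrite /fubini_F ge0_integral_distribution//.
  exact: measurableT_comp.
exact: measurable_fun_fubini_tonelli_F.
Qed.

(** The hypothesis says that the law of (X, Y) is the product of the law of X and the law of
    Y'; the conclusion is then the theorem of Tonelli. With Y' = Y this is independence of X
    and Y; with Y' on another space it also replaces Y by a copy. *)
Lemma ge0_integral_indep d (T : measurableType d) (P : probability T R)
    d' (T' : measurableType d') (P' : probability T' R)
    d1 d2 (T1 : measurableType d1) (T2 : measurableType d2)
    (X : T -> T1) (Y : T -> T2) (Y' : T' -> T2) (f : T1 * T2 -> \bar R) :
  measurable_fun setT X -> measurable_fun setT Y -> measurable_fun setT Y' ->
  (forall A C, measurable A -> measurable C ->
    P (X @^-1` A `&` Y @^-1` C) = (P (X @^-1` A) * P' (Y' @^-1` C))%E) ->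
  measurable_fun setT f -> (forall z, 0 <= f z)%E ->
  (\int[P]_w f (X w, Y w) = \int[P]_w \int[P']_w' f (X w, Y' w'))%E.
Proof.
move=> mX mY mY' ind mf f0.
have mXY : measurable_fun setT (fun w => (X w, Y w)) by exact: measurable_fun_pair.
pose X_ : {mfun T >-> T1} := HB.pack X (isMeasurableFun.Build _ _ _ _ _ mX).
pose Y_ : {mfun T' >-> T2} := HB.pack Y' (isMeasurableFun.Build _ _ _ _ _ mY').
pose XY_ : {mfun T >-> (T1 * T2)%type} :=
  HB.pack (fun w => (X w, Y w)) (isMeasurableFun.Build _ _ _ _ _ mXY).
have law E : measurable E ->
    (distribution P X_ \x distribution P' Y_)%E E = distribution P XY_ E.
  by apply: product_measure_unique => A C mA mC; exact: ind.
have sec x : measurable_fun setT (fun y => f (x, y)).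
  exact: measurableT_comp.
transitivity (\int[distribution P XY_]_z f z)%E.
  by rewrite ge0_integral_distribution.
transitivity (\int[(distribution P X_ \x distribution P' Y_)%E]_z f z)%E.
  by apply: eq_measure_integral => A mA _; exact: esym (law A mA).
rewrite fubini_tonelli1//.
rewrite ge0_integral_distribution.
- by apply: eq_integral => w _; rewrite /= /fubini_F ge0_integral_distribution.
- exact: measurable_fun_fubini_tonelli_F.
- by move=> y; exact: integral_ge0.
Qed.

End independence.

Section markov_chain.
Context {R : realType} d (T : measurableType d) (P : probability T R).
Context d0 (T0 : measurableType d0) (P0 : probability T0 R).
Context ds (S : measurableType ds) dw (W : measurableType dw).
Variables (xi : {RV P0 >-> S}) (X : nat -> {RV P >-> S}).
Hypothesis X_iid : iid_copies xi X.
Variables (F : W * S -> W) (w0 : W).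
Hypothesis mF : measurable_fun setT F.

Fixpoint chain (t : nat) (w : T) : W :=
  if t is t'.+1 then F (chain t' w, X t' w) else w0.

Lemma measurable_chain t : measurable_fun setT (chain t).
Proof.
elim: t => [|t IH]; first exact: measurable_cst.
apply: (measurableT_comp mF); exact: measurable_fun_pair.
Qed.

Let joint (J : {fset nat}) (A : nat -> set S) : set T :=
  \bigcap_(i in [set` J]) X i @^-1` A i.

Let measurable_joint J A : (forall i, measurable (A i)) -> measurable (joint J A).
Proof.
move=> mA; apply: fin_bigcap_measurable => // i _.
by rewrite -[_ @^-1` _]setTI; exact: measurable_funPT.
Qed.

(** The state at time t is independent of all samples of index at least t. The induction
    carries an arbitrary event about later samples: by the case t, the law of the pair
    (chain t, X t) restricted to an event of indices larger than t agrees on rectangles with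
    a multiple of the unrestricted law, hence also on the preimage under F of any event
    about the state at time t + 1. *)
Lemma chain_indep t (J : {fset nat}) (A : nat -> set S) (D : set W) :
  (forall i, i \in J -> (t <= i)%N) -> (forall i, measurable (A i)) ->
  measurable D ->
  P (chain t @^-1` D `&` joint J A) = (P (chain t @^-1` D) * P (joint J A))%E.
Proof.
elim: t J A D => [|t IH] J A D Jt mA mD.
  have [w0D|w0D] := pselect (D w0).
    have -> : chain 0 @^-1` D = setT by apply/seteqP; split.
    by rewrite setTI probability_setT mul1e.
  have -> : chain 0 @^-1` D = set0 by apply/seteqP; split.
  by rewrite set0I measure0 mul0e.
have tJ : t \notin J by apply/negP => /Jt; rewrite ltnn.
pose upd C i := if i == t then C else A i.
have mupd C : measurable C -> forall i, measurable (upd C i).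
  by move=> mC i; rewrite /upd; case: ifP.
have jointU C : joint (t |` J)%fset (upd C) = X t @^-1` C `&` joint J A.
  apply/seteqP; split => w.
    move=> h; split.
      by have := h t; rewrite /= fset1U1 /upd eqxx; exact.
    move=> i /= iJ; have := h i; rewrite /= /upd fset1Ur//.
    by rewrite (negPf (memPn tJ i iJ)); exact.
  move=> [Ct h] i /=; rewrite /upd in_fset1U; case: eqVneq => [->//|_ /= iJ].
  exact: h.
have joint1 C : joint [fset t]%fset (upd C) = X t @^-1` C.
  rewrite -[[fset t]%fset]fsetU0; apply/seteqP; split => w.
    by move=> /(_ t); rewrite /= fset1U1 /upd eqxx; exact.
  by move=> Ct i /=; rewrite fsetU0 inE /upd => /eqP ->; rewrite eqxx.
have indU C : measurable C ->
    P (X t @^-1` C `&` joint J A) = (P (X t @^-1` C) * P (joint J A))%E.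
  move=> mC; rewrite -jointU (X_iid.1 _ _ (mupd C mC)) big_fsetU1//=.
  rewrite {1}/upd eqxx; congr (_ * _)%E.
  rewrite (X_iid.1 _ _ mA); rewrite big_seq [RHS]big_seq.
  by apply: eq_bigr => i iJ; rewrite /upd (negPf (memPn tJ i iJ)).
have geU i : i \in (t |` J)%fset -> (t <= i)%N.
  by rewrite in_fset1U => /orP[/eqP->//|/Jt/ltnW].
have ge1 i : i \in [fset t]%fset -> (t <= i)%N by rewrite inE => /eqP ->.
have mQ : measurable_fun setT (fun w => (chain t w, X t w)).
  by apply: measurable_fun_pair => //; exact: measurable_chain.
pose Q : {mfun T >-> (W * S)%type} :=
  HB.pack (fun w => (chain t w, X t w)) (isMeasurableFun.Build _ _ _ _ _ mQ).
have mJ := measurable_joint J mA.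
have finJ : P (joint J A) \is a fin_num by exact: fin_num_measure.
pose c := NngNum (fine_ge0 (measure_ge0 P (joint J A))).
have [m1 m1E] : exists m : {measure set (W * S) -> \bar R},
    forall E, m E = P (Q @^-1` E `&` joint J A).
  by unshelve eexists (pushforward (mrestr P mJ) Q); first exact: mQ.
pose m2 : {measure set (W * S) -> \bar R} := mscale c (distribution P Q).
have m2E E : m2 E = (P (joint J A) * P (Q @^-1` E))%E.
  by rewrite /m2 /= /mscale /= fineK.
have m12 : forall E, measurable E -> m1 E = m2 E.
  apply: eq_measure_rectangles => [B C mB mC|].
    rewrite m1E m2E.
    have -> : Q @^-1` (B `*` C) = chain t @^-1` B `&` X t @^-1` C by [].
    have mC' := mupd C mC.
    rewrite -setIA -jointU IH// jointU indU//.
    by rewrite -[in RHS](joint1 C) IH// joint1 muleA muleC.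
  rewrite m1E setTI; apply: (@le_lt_trans _ _ (P setT)).
    by apply: le_measure; rewrite ?inE.
  by rewrite probability_setT ltry.
have mFD : measurable (F @^-1` D) by rewrite -[_ @^-1` _]setTI; exact: mF.
have := m12 _ mFD.
by rewrite m1E m2E muleC.
Qed.

Lemma chain_indep_next t D C : measurable D -> measurable C ->
  P (chain t @^-1` D `&` X t @^-1` C) =
  (P (chain t @^-1` D) * P0 (xi @^-1` C))%E.
Proof.
move=> mD mC.
have -> : X t @^-1` C = joint [fset t]%fset (fun=> C).
  apply/seteqP; split => w; first by move=> Ct i /=; rewrite inE => /eqP ->.
  by move=> /(_ t); rewrite /= inE eqxx; exact.
rewrite chain_indep//; last by move=> i; rewrite inE => /eqP ->.
rewrite (X_iid.1 [fset t]%fset (fun=> C) (fun=> mC)) big_seq_fset1.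
congr (_ * _)%E; exact: (X_iid.2 t C mC).
Qed.

(** Foster-Lyapunov: a one-step drift bound under the law of one sample, uniform in the
    starting state, sums up along the chain. *)
Lemma chain_drift (V : W -> R) (C : R) (t : nat) :
  measurable_fun setT V -> (forall w, 0 <= V w) -> 0 <= C ->
  (forall w, \int[P0]_s (V (F (w, xi s)))%:E <= (V w + C)%:E)%E ->
  (\int[P]_w (V (chain t w))%:E <= (V w0 + C * t%:R)%:E)%E.
Proof.
move=> mV V0 C0 drift; elim: t => [|t IH].
  by rewrite /= integral_cst//= probability_setT mule1 mulr0 addr0.
have mVc : measurable_fun setT (fun w => (V (chain t w))%:E).
  apply/measurable_EFinP; apply: measurableT_comp => //; exact: measurable_chain.
have -> : (\int[P]_w (V (chain t.+1 w))%:E =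
    \int[P]_w \int[P0]_s (V (F (chain t w, xi s)))%:E)%E.
  apply: (@ge0_integral_indep _ _ _ P _ _ P0 _ _ _ _ (chain t) (X t) xi
    (fun z => (V (F z))%:E)) => //.
  - exact: measurable_chain.
  - by move=> A B mA mB; exact: chain_indep_next.
  - by apply/measurable_EFinP; exact: measurableT_comp.
  - by move=> z; rewrite lee_fin.
apply: (@le_trans _ _ (\int[P]_w ((V (chain t w))%:E + C%:E))%E).
  apply: ge0_le_integral => //.
  - by move=> w _; apply: integral_ge0 => s _; rewrite lee_fin.
  - apply: (measurableT_comp
      (f := fun x => (\int[P0]_s (V (F (x, xi s)))%:E)%E)).
      apply: (@measurable_section_integral _ _ _ P0 _ _ _ _ xi
        (fun z => (V (F z))%:E)) => //.
        by apply/measurable_EFinP; exact: measurableT_comp.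
      by move=> z; rewrite lee_fin.
    exact: measurable_chain.
  - exact: emeasurable_funD.
rewrite ge0_integralD//; [|by move=> w _; rewrite lee_fin..].
rewrite integral_cst//= probability_setT mule1.
apply: le_trans (leeD2r _ IH) _.
by rewrite -EFinD lee_fin -addrA -[t.+1]addn1 natrD mulrDr mulr1.
Qed.

End markov_chain.

(** * Means and measurability of random matrices *)

Section means.
Context {R : realType} d (T : measurableType d) (P : probability T R).
Implicit Types (f g : T -> R).

(** Integrability and the value of the integral are bundled in one relation: it is stable
    under linear operations without side conditions, and means of polynomial expressions
    are computed by composing these stability lemmas. *)
Definition has_mean f (m : R) : Prop :=
  P.-integrable [set: T] (fun w => (f w)%:E) /\ (\int[P]_w (f w)%:E = m%:E)%E.

Lemma has_mean_cst c : has_mean (fun=> c) c.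
Proof.
split; first exact: finite_measure_integrable_cst.
by rewrite integral_cst//= probability_setT mule1.
Qed.

Lemma has_meanD f g a b : has_mean f a -> has_mean g b ->
  has_mean (fun w => f w + g w) (a + b).
Proof.
move=> [fi fa] [gi gb]; split.
  by under eq_fun do rewrite EFinD; exact: integrableD.
by under eq_integral do rewrite EFinD; rewrite integralD// fa gb.
Qed.

Lemma has_meanZ c f a : has_mean f a -> has_mean (fun w => c * f w) (c * a).
Proof.
move=> [fi fa]; split.
  by under eq_fun do rewrite EFinM; exact: integrableZl.
by under eq_integral do rewrite EFinM; rewrite integralZl// fa.
Qed.

Lemma has_mean_sum (I : Type) (r : seq I) (f : I -> T -> R) (a : I -> R) :
  (forall i, has_mean (f i) (a i)) ->
  has_mean (fun w => \sum_(i <- r) f i w) (\sum_(i <- r) a i).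
Proof.
move=> fa; elim: r => [|i r IH].
  by rewrite big_nil; under [X in has_mean X]eq_fun do rewrite big_nil;
    exact: has_mean_cst.
by rewrite big_cons; under [X in has_mean X]eq_fun do rewrite big_cons;
  exact: has_meanD.
Qed.

Lemma has_mean_ext f g a b : has_mean g b -> f =1 g -> a = b -> has_mean f a.
Proof. by move=> h /funext -> ->. Qed.

Lemma has_mean_unique f a b : has_mean f a -> has_mean f b -> a = b.
Proof. by move=> [_ fa] [_]; rewrite fa => -[]. Qed.

Lemma has_mean_le f g a b : has_mean f a -> has_mean g b ->
  (forall w, f w <= g w) -> a <= b.
Proof.
move=> [fi fa] [gi gb] fg; rewrite -lee_fin -fa -gb.
by apply: le_integral => // w _; rewrite lee_fin.
Qed.

Lemma has_mean_ge0 f a : has_mean f a -> (forall w, 0 <= f w) -> 0 <= a.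
Proof. by move=> fa; apply: has_mean_le fa; exact: has_mean_cst. Qed.

Definition mx_mean m n (X : T -> 'M[R]_(m, n)) (M : 'M[R]_(m, n)) : Prop :=
  forall i j, has_mean (fun w => X w i j) (M i j).

Lemma mx_mean_expectation m n (X : T -> 'M[R]_(m, n)) :
  mx_integrable P X -> mx_mean X (mx_expectation P X).
Proof.
move=> Xi i j; split; first exact: Xi.
rewrite mxE fineK unlock//; apply: integrable_fin_num => //; exact: Xi.
Qed.

Section matrix_means.
Context {m n : nat}.
Implicit Types (X Y : T -> 'M[R]_(m, n)) (M N : 'M[R]_(m, n)).

Lemma mx_mean_cst M : mx_mean (fun=> M) M.
Proof. by move=> i j; exact: has_mean_cst. Qed.

Lemma mx_meanD X Y M N : mx_mean X M -> mx_mean Y N ->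
  mx_mean (fun w => X w + Y w) (M + N).
Proof.
move=> XM YN i j; apply: has_mean_ext (has_meanD (XM i j) (YN i j)) _ _.
  by move=> w; rewrite mxE.
by rewrite mxE.
Qed.

Lemma mx_meanZ c X M : mx_mean X M -> mx_mean (fun w => c *: X w) (c *: M).
Proof.
move=> XM i j; apply: has_mean_ext (has_meanZ c (XM i j)) _ _.
  by move=> w; rewrite mxE.
by rewrite mxE.
Qed.

Lemma mx_meanN X M : mx_mean X M -> mx_mean (fun w => - X w) (- M).
Proof.
move=> XM; have := mx_meanZ (-1) XM.
by rewrite scaleN1r; under [X in mx_mean X]eq_fun do rewrite scaleN1r.
Qed.

Lemma mx_meanB X Y M N : mx_mean X M -> mx_mean Y N ->
  mx_mean (fun w => X w - Y w) (M - N).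
Proof. by move=> XM YN; apply: mx_meanD => //; exact: mx_meanN. Qed.

Lemma mx_mean_tr X M : mx_mean X M -> mx_mean (fun w => (X w)^T) M^T.
Proof.
move=> XM i j; apply: has_mean_ext (XM j i) _ _ => [w|]; by rewrite mxE.
Qed.

Lemma mx_mean_mulmxl k (A : 'M[R]_(k, m)) X M :
  mx_mean X M -> mx_mean (fun w => A *m X w) (A *m M).
Proof.
move=> XM i j.
apply: has_mean_ext (has_mean_sum _ (fun l => has_meanZ (A i l) (XM l j))) _ _.
  by move=> w; rewrite mxE.
by rewrite mxE.
Qed.

Lemma mx_mean_unique X M N : mx_mean X M -> mx_mean X N -> M = N.
Proof.
by move=> XM XN; apply/matrixP => i j; exact: has_mean_unique (XM i j) (XN i j).
Qed.

End matrix_means.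

Lemma mx_mean_mulmxr m n k (A : 'M[R]_(n, k)) (X : T -> 'M[R]_(m, n)) M :
  mx_mean X M -> mx_mean (fun w => X w *m A) (M *m A).
Proof.
move=> XM; have := mx_mean_tr (mx_mean_mulmxl A^T (mx_mean_tr XM)).
rewrite trmx_mul !trmxK.
by under [X in mx_mean X]eq_fun do rewrite trmx_mul !trmxK.
Qed.

Lemma mx_mean_block m1 m2 n1 n2 (A : T -> 'M[R]_(m1, n1)) (B : T -> 'M[R]_(m1, n2))
    (C : T -> 'M[R]_(m2, n1)) (D : T -> 'M[R]_(m2, n2)) a b c e :
  mx_mean A a -> mx_mean B b -> mx_mean C c -> mx_mean D e ->
  mx_mean (fun w => block_mx (A w) (B w) (C w) (D w)) (block_mx a b c e).
Proof.
move=> Aa Bb Cc De i j.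
case: (split_ordP i) => k ->; case: (split_ordP j) => l ->.
- by apply: has_mean_ext (Aa k l) _ _ => [w|]; rewrite block_mxEul.
- by apply: has_mean_ext (Bb k l) _ _ => [w|]; rewrite block_mxEur.
- by apply: has_mean_ext (Cc k l) _ _ => [w|]; rewrite block_mxEdl.
- by apply: has_mean_ext (De k l) _ _ => [w|]; rewrite block_mxEdr.
Qed.

Lemma mx_mean_col m1 m2 n (A : T -> 'M[R]_(m1, n)) (C : T -> 'M[R]_(m2, n)) a c :
  mx_mean A a -> mx_mean C c ->
  mx_mean (fun w => col_mx (A w) (C w)) (col_mx a c).
Proof.
move=> Aa Cc i j; case: (split_ordP i) => k ->.
- by apply: has_mean_ext (Aa k j) _ _ => [w|]; rewrite col_mxEu.
- by apply: has_mean_ext (Cc k j) _ _ => [w|]; rewrite col_mxEd.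
Qed.

Lemma mx_mean_tr_mul m n (A : 'M[R]_(n, m)) (X : T -> 'M[R]_(m, n)) M :
  mx_mean X M -> has_mean (fun w => \tr (A *m X w)) (\tr (A *m M)).
Proof.
move=> XM; apply: has_mean_sum => i; exact: mx_mean_mulmxl.
Qed.

Lemma mx_mean_dot m n (u : 'cV[R]_m) (v : 'cV[R]_n) (X : T -> 'M[R]_(m, n)) M :
  mx_mean X M -> has_mean (fun w => dot u (X w *m v)) (dot u (M *m v)).
Proof. by move=> XM; exact: mx_mean_mulmxl (mx_mean_mulmxr _ XM) _ _. Qed.

Lemma mx_mean_dotl n (u : 'cV[R]_n) (X : T -> 'cV[R]_n) M :
  mx_mean X M -> has_mean (fun w => dot u (X w)) (dot u M).
Proof. by move=> XM; exact: mx_mean_mulmxl XM _ _. Qed.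

End means.

Section measurable_matrices.
Context {R : realType} d (T : measurableType d).

Lemma measurable_mxP m n (X : T -> 'M[R]_(m, n)) :
  measurable_fun setT X <->
  forall i j, measurable_fun setT (fun w => X w i j).
Proof.
split => [mX i j|mX].
  have mc : measurable_fun setT (fun A : 'M[R]_(m, n) => A i j).
    move=> _ C mC; apply: sub_sigma_algebra.
    by exists (i, j) => //; exists C.
  exact: (measurableT_comp mc).
apply: (measurability (@mx_cylinders _ _ m n)) => //.
move=> _ [_ [[i j] _ [C mC <-]] <-].
rewrite !setTI.
by have := mX i j measurableT C mC; rewrite setTI.
Qed.

Lemma measurable_mxD m n (X Y : T -> 'M[R]_(m, n)) :
  measurable_fun setT X -> measurable_fun setT Y ->
  measurable_fun setT (fun w => X w + Y w).
Proof.
move=> /measurable_mxP mX /measurable_mxP mY; apply/measurable_mxP => i j.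
by under eq_fun do rewrite mxE; exact: measurable_funD.
Qed.

Lemma measurable_mulmx m n k (X : T -> 'M[R]_(m, n)) (Y : T -> 'M[R]_(n, k)) :
  measurable_fun setT X -> measurable_fun setT Y ->
  measurable_fun setT (fun w => X w *m Y w).
Proof.
move=> /measurable_mxP mX /measurable_mxP mY; apply/measurable_mxP => i j.
by under eq_fun do rewrite mxE; apply: measurable_sum => l; exact: measurable_funM.
Qed.

Lemma measurable_mxZ m n c (X : T -> 'M[R]_(m, n)) :
  measurable_fun setT X -> measurable_fun setT (fun w => c *: X w).
Proof.
move=> /measurable_mxP mX; apply/measurable_mxP => i j.
by under eq_fun do rewrite mxE; exact: measurable_funM.
Qed.

Lemma measurable_mxB m n (X Y : T -> 'M[R]_(m, n)) :
  measurable_fun setT X -> measurable_fun setT Y ->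
  measurable_fun setT (fun w => X w - Y w).
Proof.
move=> mX mY; under eq_fun do rewrite -scaleN1r.
by apply: measurable_mxD => //; exact: measurable_mxZ.
Qed.

Lemma measurable_trmx m n (X : T -> 'M[R]_(m, n)) :
  measurable_fun setT X -> measurable_fun setT (fun w => (X w)^T).
Proof.
move=> /measurable_mxP mX; apply/measurable_mxP => i j.
by under eq_fun do rewrite mxE; exact: mX.
Qed.

Lemma measurable_dot n (X Y : T -> 'cV[R]_n) :
  measurable_fun setT X -> measurable_fun setT Y ->
  measurable_fun setT (fun w => dot (X w) (Y w)).
Proof.
move=> mX mY; have /measurable_mxP := measurable_mulmx (measurable_trmx mX) mY.
exact.
Qed.

Lemma measurable_block_mx m1 m2 n1 n2 (A : T -> 'M[R]_(m1, n1))
    (B : T -> 'M[R]_(m1, n2)) (C : T -> 'M[R]_(m2, n1)) (D : T -> 'M[R]_(m2, n2)) :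
  measurable_fun setT A -> measurable_fun setT B ->
  measurable_fun setT C -> measurable_fun setT D ->
  measurable_fun setT (fun w => block_mx (A w) (B w) (C w) (D w)).
Proof.
move=> /measurable_mxP mA /measurable_mxP mB /measurable_mxP mC /measurable_mxP mD.
apply/measurable_mxP => i j.
case: (split_ordP i) => k ->; case: (split_ordP j) => l ->.
- by under eq_fun do rewrite block_mxEul; exact: mA.
- by under eq_fun do rewrite block_mxEur; exact: mB.
- by under eq_fun do rewrite block_mxEdl; exact: mC.
- by under eq_fun do rewrite block_mxEdr; exact: mD.
Qed.

Lemma measurable_col_mx m1 m2 n (A : T -> 'M[R]_(m1, n)) (B : T -> 'M[R]_(m2, n)) :
  measurable_fun setT A -> measurable_fun setT B ->
  measurable_fun setT (fun w => col_mx (A w) (B w)).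
Proof.
move=> /measurable_mxP mA /measurable_mxP mB; apply/measurable_mxP => i j.
case: (split_ordP i) => k ->.
- by under eq_fun do rewrite col_mxEu; exact: mA.
- by under eq_fun do rewrite col_mxEd; exact: mB.
Qed.

End measurable_matrices.

(** * Extragradient with a random skew matrix *)

Section skew_step.
Context {R : realType} {N : nat}.
Implicit Types (J : 'M[R]_N) (z h b c : 'cV[R]_N) (eta : R).

(** Both half steps with the same sample: the linear part J is skew, and h is the additive
    noise. *)
Definition skew_step eta J h z : 'cV[R]_N :=
  z - eta *: (J *m (z - eta *: (J *m z + h)) + h).

Definition gram J : 'M[R]_N := J^T *m J.

Lemma skew_dot J z : J^T = - J -> dot z (J *m z) = 0.
Proof.
move=> Js; have : dot z (J *m z) = - dot z (J *m z).
  by rewrite {1}dot_mulmx Js mulNmx dotNl dotC.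
lra.
Qed.

Lemma gram_skewE J z : J^T = - J -> gram J *m z = - (J *m (J *m z)).
Proof. by move=> Js; rewrite /gram Js mulNmx mulmxA mulNmx. Qed.

Lemma dot_gram J z : dot z (gram J *m z) = dot (J *m z) (J *m z).
Proof. by rewrite /gram -mulmxA dot_mulmx trmxK. Qed.

Lemma tr_gram J : (gram J)^T = gram J.
Proof. by rewrite /gram trmx_mul trmxK. Qed.

Lemma dot_gram_gram J z :
  dot z (gram J *m gram J *m z) = dot (gram J *m z) (gram J *m z).
Proof. by rewrite -mulmxA dot_mulmx tr_gram. Qed.

Lemma skew_stepE eta J h z : J^T = - J ->
  skew_step eta J h z =
  (z - eta *: (J *m z) - eta ^+ 2 *: (gram J *m z)) - eta *: (h - eta *: (J *m h)).
Proof.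
move=> Js; rewrite gram_skewE// /skew_step mulmxBr -scalemxAr mulmxDr.
set a := J *m z; set e := J *m a; set f := J *m h.
by apply/matrixP => i j; rewrite !mxE; ring.
Qed.

(** Since J is skew, z and J z are orthogonal, as are J z and J^2 z; only the cross term of
    z and J^2 z = - gram J z survives, which is the gain of extragradient. *)
Lemma dot_skew_drift eta J z : J^T = - J ->
  let p := z - eta *: (J *m z) - eta ^+ 2 *: (gram J *m z) in
  dot p p = dot z z - eta ^+ 2 * dot z (gram J *m z)
            + eta ^+ 4 * dot z (gram J *m gram J *m z).
Proof.
move=> Js /=.
have e1 := skew_dot z Js.
have e2 : dot (J *m z) (gram J *m z) = 0.
  by rewrite gram_skewE// dotNr skew_dot// oppr0.
rewrite dot_gram_gram !dot_lin (dotC (J *m z) z) (dotC (gram J *m z) z).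
rewrite (dotC (gram J *m z) (J *m z)) e1 e2 -dot_gram; ring.
Qed.

Lemma dot_skew_noise eta J h : J^T = - J ->
  let q := h - eta *: (J *m h) in
  dot q q = dot h h + eta ^+ 2 * dot h (gram J *m h).
Proof.
move=> Js /=; rewrite !dot_lin (dotC (J *m h) h) (skew_dot h Js) dot_gram; ring.
Qed.

Lemma dot_trace (A : 'M[R]_N) h : dot h (A *m h) = \tr (A *m (h *m h^T)).
Proof. by rewrite mulmxA mxtrace_mulC mulmxA [RHS]big_ord1 /dot -mulmxA. Qed.

Lemma dot_trace1 h : dot h h = \tr (h *m h^T).
Proof. by rewrite -{2}[h]mul1mx dot_trace mul1mx. Qed.

End skew_step.

Section skew_extragradient.
Context {R : realType} d (T : measurableType d) (P : probability T R) {N : nat}.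
Variables (J : T -> 'M[R]_N) (h : T -> 'cV[R]_N).
Variables (Jm Sm S2m VJ VS H : 'M[R]_N).
Variables (eta rho lam vB vB2 vg : R).
Let S w := gram (J w).
Hypothesis J_meas : measurable_fun setT J.
Hypothesis J_skew : forall w, (J w)^T = - J w.
Hypothesis J_mean : mx_mean P J Jm.
Hypothesis S_mean : mx_mean P S Sm.
Hypothesis S2_mean : mx_mean P (fun w => S w *m S w) S2m.
Hypothesis VJ_mean : mx_mean P (fun w => gram (J w - Jm)) VJ.
Hypothesis VS_mean : mx_mean P (fun w => (S w - Sm) *m (S w - Sm)) VS.
Hypothesis VJ_le : forall z, dot z (VJ *m z) <= vB * dot z z.
Hypothesis VS_le : forall z, dot z (VS *m z) <= vB2 * dot z z.
Hypothesis S2_le : forall z, dot z (S2m *m z) <= rho * dot z (Sm *m z).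
Hypothesis S_ge : forall z, lam * dot z z <= dot z (Sm *m z).
Hypothesis h_mean : mx_mean P h 0.
Hypothesis hh_mean : mx_mean P (fun w => h w *m (h w)^T) H.
Hypothesis H_le : \tr H <= vg.
Hypothesis eta_gt0 : 0 < eta.
Hypothesis rho_gt0 : 0 < rho.
Hypothesis eta_rho : 2 * (eta ^+ 2 * rho) <= 1.

Lemma Jm_skew : Jm^T = - Jm.
Proof.
apply: mx_mean_unique (mx_mean_tr J_mean) _.
have -> : (fun w => (J w)^T) = (fun w => - J w) by apply/funext => w; exact: J_skew.
exact: mx_meanN.
Qed.

Lemma Sm_sym : Sm^T = Sm.
Proof.
apply: mx_mean_unique (mx_mean_tr S_mean) _.
by under [X in mx_mean _ X]eq_fun do rewrite tr_gram.
Qed.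

Lemma Sm_quadratic_ge0 z : 0 <= dot z (Sm *m z).
Proof.
apply: has_mean_ge0 (mx_mean_dot z z S_mean) _ => w.
by rewrite dot_gram dot_ge0.
Qed.

(** Jensen: the difference is the mean of |S z - Sm z|^2. *)
Lemma Sm_sqr_le z : dot (Sm *m z) (Sm *m z) <= dot z (S2m *m z).
Proof.
rewrite -subr_ge0.
have m1 := mx_mean_dot z z S2_mean.
have m2 := has_meanZ (-2) (mx_mean_dot (Sm *m z) z S_mean).
have m3 := has_mean_cst P (dot (Sm *m z) (Sm *m z)).
apply: has_mean_ge0 (has_mean_ext (has_meanD (has_meanD m1 m2) m3)
  (f := fun w => dot (S w *m z - Sm *m z) (S w *m z - Sm *m z)) _ _) _.
- by move=> w; rewrite /S dot_gram_gram !dot_lin (dotC (gram (J w) *m z)); ring.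
- ring.
- by move=> w; exact: dot_ge0.
Qed.

(** With q = z . Sm z, the Jensen bound gives |Sm z|^2 <= rho q, and Cauchy-Schwarz
    gives q^2 <= |z|^2 |Sm z|^2. *)
Lemma Sm_le z : dot z (Sm *m z) <= rho * dot z z.
Proof.
have q0 := Sm_quadratic_ge0 z.
have [->|qn0] := eqVneq (dot z (Sm *m z)) 0.
  by rewrite mulr_ge0 ?dot_ge0// ltW.
have qp : 0 < dot z (Sm *m z) by rewrite lt_def qn0.
have h1 := dot_CauchySchwarz z (Sm *m z).
have h2 := le_trans (Sm_sqr_le z) (S2_le z).
rewrite -(ler_pM2r qp) -expr2; apply: le_trans h1 _.
apply: le_trans (ler_wpM2l (dot_ge0 z) h2) _; lra.
Qed.

Lemma variance_gram : VJ = Sm - gram Jm.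
Proof.
apply: mx_mean_unique VJ_mean _.
have m := mx_meanD (mx_meanB (mx_meanB S_mean (mx_mean_mulmxl Jm^T J_mean))
  (mx_mean_mulmxr Jm (mx_mean_tr J_mean))) (mx_mean_cst P (gram Jm)).
suff eS : (fun w => gram (J w - Jm)) =
    (fun w => S w - Jm^T *m J w - (J w)^T *m Jm + gram Jm).
  by rewrite eS (_ : Sm - gram Jm = Sm - Jm^T *m Jm - Jm^T *m Jm + gram Jm)// subrK.
apply/funext => w; rewrite /S /gram [(J w - Jm)^T]linearB /= mulmxBr !mulmxBl opprB addrA.
by rewrite addrAC.
Qed.

(** Write u = Jm v. Since Sm = gram Jm + VJ and u . (gram Jm) v = (Jm u) . u = 0, the
    cross term of |u + eta Sm v|^2 is 2 eta u . VJ v. By Young with weight 1 / sqrt mu and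
    mu |v|^2 <= |u|^2 it is at least - 2 eta vB |u|^2 / sqrt mu, and the bound on the step
    size makes this at least - alpha |u|^2. *)
Lemma mean_field_lower_bound (alpha mu : R) :
  0 < mu -> (forall v, mu * dot v v <= dot (Jm *m v) (Jm *m v)) ->
  0 <= vB -> 2 * eta * vB <= alpha * Num.sqrt mu -> alpha < 1 ->
  forall v, (1 - alpha) * mu * dot v v <=
    dot ((Jm + eta *: Sm) *m v) ((Jm + eta *: Sm) *m v).
Proof.
move=> mu0 Jm_ge vB0 eta_vB alpha1 v.
set s := Num.sqrt mu in eta_vB; have s0 : 0 < s by rewrite sqrtr_gt0.
have ss : s ^+ 2 = mu by rewrite sqr_sqrtr// ltW.
set u := Jm *m v.
have cross : dot u (Sm *m v) = dot u (VJ *m v).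
  have gu : dot u (gram Jm *m v) = dot u (Jm *m u).
    by rewrite [RHS]dotC /gram -mulmxA dot_mulmx trmxK.
  by rewrite variance_gram mulmxBl dotBr gu (skew_dot u Jm_skew) subr0.
have uv := mx_mean_dot u v VJ_mean.
have uu := mx_mean_dot u u VJ_mean.
have vv := mx_mean_dot v v VJ_mean.
have lo : - (s^-1 * dot u (VJ *m u) + s * dot v (VJ *m v)) <= 2 * dot u (VJ *m v).
  apply: (has_mean_le (f := fun w => - 1 * (s^-1 * dot u (gram (J w - Jm) *m u)
      + s * dot v (gram (J w - Jm) *m v))) _ (has_meanZ 2 uv)).
    apply: has_mean_ext (has_meanZ (-1) (has_meanD (has_meanZ s^-1 uu) (has_meanZ s vv))) _ _ => //.
    by rewrite mulN1r.
  move=> w; rewrite mulN1r !dot_gram.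
  have -> : dot u (gram (J w - Jm) *m v) = dot ((J w - Jm) *m u) ((J w - Jm) *m v).
    by rewrite /gram -mulmxA dot_mulmx trmxK.
  have := dot_young ((J w - Jm) *m u) ((J w - Jm) *m v) (_ : 0 < s^-1).
  by rewrite invrK invr_gt0; apply.
have lo2 : - (2 * vB * s^-1 * dot u u) <= 2 * dot u (Sm *m v).
  rewrite cross; apply: le_trans lo; rewrite lerN2.
  have a1 : s^-1 * dot u (VJ *m u) <= s^-1 * (vB * dot u u).
    by rewrite ler_wpM2l ?VJ_le// invr_ge0 ltW.
  have a2 : s * dot v (VJ *m v) <= vB * (s^-1 * dot u u).
    apply: (@le_trans _ _ (s * (vB * dot v v))).
      by rewrite ler_wpM2l ?VJ_le// ltW.
    rewrite mulrCA ler_wpM2l// -(ler_pM2l s0) !mulrA divff ?gt_eqF// mul1r.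
    by rewrite -expr2 ss.
  apply: le_trans (lerD a1 a2) _; rewrite le_eqVlt; apply/orP; left; apply/eqP; ring.
have GE : dot ((Jm + eta *: Sm) *m v) ((Jm + eta *: Sm) *m v) =
    dot u u + eta * (2 * dot u (Sm *m v)) + eta ^+ 2 * dot (Sm *m v) (Sm *m v).
  rewrite mulmxDl -scalemxAl -/u !dot_lin (dotC (Sm *m v) u); ring.
rewrite GE.
have k1 : eta * - (2 * vB * s^-1 * dot u u) <= eta * (2 * dot u (Sm *m v)).
  by rewrite ler_wpM2l// ltW.
have k2 : 0 <= eta ^+ 2 * dot (Sm *m v) (Sm *m v).
  by rewrite mulr_ge0 ?sqr_ge0// dot_ge0.
have k3 : 2 * eta * vB * s^-1 <= alpha by rewrite ler_pdivrMr.
have k4 : 2 * eta * vB * s^-1 * dot u u <= alpha * dot u u.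
  by rewrite ler_wpM2r// dot_ge0.
have k5 : (1 - alpha) * (mu * dot v v) <= (1 - alpha) * dot u u.
  by rewrite ler_wpM2l ?Jm_ge// subr_ge0 ltW.
have k6 : eta * - (2 * vB * s^-1 * dot u u) = - (2 * eta * vB * s^-1 * dot u u) by ring.
rewrite -mulrA; lra.
Qed.

(** The iterate z is carried along with the two noises accumulated by the mean dynamics: b
    collects the multiplicative noise of the matrices, c the additive noise. *)
Definition state_step (A : 'M[R]_N) (g : 'cV[R]_N) (s : 'cV[R]_N * 'cV[R]_N * 'cV[R]_N) :
    'cV[R]_N * 'cV[R]_N * 'cV[R]_N :=
  let: (z, b, c) := s in
  (skew_step eta A g z,
   b + ((A - Jm) *m z + eta *: ((gram A - Sm) *m z)),
   c + (g - eta *: (A *m g))).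

(** The weights 2 and 4 are those with which b and c enter the bound on the sum of the
    iterates: |u + v|^2 <= 2 |u|^2 + 2 |v|^2 is used once for b and twice for c. *)
Definition lyapunov (a : R) (s : 'cV[R]_N * 'cV[R]_N * 'cV[R]_N) : R :=
  2 * dot s.1.2 s.1.2 + 4 * dot s.2 s.2 + a * dot s.1.1 s.1.1.

Let noise_var (A : 'M[R]_N) : R := \tr H + eta ^+ 2 * \tr (gram A *m H).

Lemma noise_mean (A : 'M[R]_N) : A^T = - A ->
  mx_mean P (fun w => h w - eta *: (A *m h w)) 0 /\
  has_mean P (fun w => dot (h w - eta *: (A *m h w)) (h w - eta *: (A *m h w)))
    (noise_var A).
Proof.
move=> As; split.
  have := mx_meanB h_mean (mx_meanZ eta (mx_mean_mulmxl A h_mean)).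
  by rewrite mulmx0 scaler0 subr0.
have m1 := mx_mean_tr_mul 1%:M hh_mean.
have m2 := has_meanZ (eta ^+ 2) (mx_mean_tr_mul (gram A) hh_mean).
apply: has_mean_ext (has_meanD m1 m2) _ _.
  by move=> w; rewrite dot_skew_noise// dot_trace dot_trace1 mul1mx.
by rewrite mul1mx.
Qed.

(** For a fixed matrix all terms linear in the additive noise have mean 0. *)
Lemma lyapunov_noise_mean a (A : 'M[R]_N) z b c : A^T = - A ->
  let p := z - eta *: (A *m z) - eta ^+ 2 *: (gram A *m z) in
  let b' := b + ((A - Jm) *m z + eta *: ((gram A - Sm) *m z)) in
  has_mean P (fun w => lyapunov a (state_step A (h w) (z, b, c)))
    (2 * dot b' b' + 4 * dot c c + a * dot p p
     + (4 + a * eta ^+ 2) * noise_var A).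
Proof.
move=> As p b'; have [q0 qq] := noise_mean As.
have m1 := has_mean_cst P (2 * dot b' b' + 4 * dot c c + a * dot p p).
have m2 := has_meanZ (4 + a * eta ^+ 2) qq.
have m3 := mx_mean_dotl (8 *: c - (2 * a * eta) *: p) q0.
apply: has_mean_ext (has_meanD (has_meanD m1 m2) m3) _ _; last first.
  by rewrite dot0r addr0.
move=> w; rewrite /lyapunov /state_step /= skew_stepE// -/p -/b'.
have expand (B : R) (q r : 'cV[R]_N) :
    B + 4 * dot (c + q) (c + q) + a * dot (r - eta *: q) (r - eta *: q) =
    B + 4 * dot c c + a * dot r r + (4 + a * eta ^+ 2) * dot q q
    + dot (8 *: c - (2 * a * eta) *: r) q.
  by rewrite !dot_lin (dotC q c) (dotC q r); ring.
exact: expand.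
Qed.

Lemma noise_var_le : has_mean P (fun w => noise_var (J w)) (\tr H + eta ^+ 2 * \tr (Sm *m H))
  /\ \tr H + eta ^+ 2 * \tr (Sm *m H) <= 3 / 2 * vg.
Proof.
split.
  apply: has_meanD; first exact: has_mean_cst.
  apply: has_meanZ.
  have := mx_mean_tr_mul H S_mean.
  rewrite mxtrace_mulC.
  by under [X in has_mean _ X]eq_fun do rewrite mxtrace_mulC.
have m1 := mx_mean_tr_mul Sm hh_mean.
have m2 := has_meanZ rho (mx_mean_tr_mul 1%:M hh_mean).
have m0 := mx_mean_tr_mul 1%:M hh_mean.
have trH0 : 0 <= \tr H.
  rewrite -[H]mul1mx; apply: has_mean_ge0 m0 _ => w.
  by rewrite mul1mx -dot_trace1 dot_ge0.
have : \tr (Sm *m H) <= rho * \tr H.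
  have := has_mean_le m1 m2; rewrite mul1mx; apply => w.
  by rewrite mul1mx -dot_trace -dot_trace1 Sm_le.
move=> le1.
have le2 : eta ^+ 2 * \tr (Sm *m H) <= eta ^+ 2 * (rho * \tr H).
  by rewrite ler_wpM2l// sqr_ge0.
have le3 : 2 * (eta ^+ 2 * rho) * \tr H <= 1 * \tr H by rewrite ler_wpM2r.
have e : 2 * (eta ^+ 2 * rho) * \tr H = 2 * (eta ^+ 2 * (rho * \tr H)) by ring.
rewrite e mul1r in le3; have := H_le; lra.
Qed.

(** The average over the additive noise is taken first, with the matrix fixed, so that no
    mixed moment of the two noises occurs. Then, averaging over the matrix, z loses
    (eta^2 / 2) lam |z|^2, while b gains at most 2 (vB + eta^2 vB2) |z|^2; the assumption on
    a says that the loss pays for the gain, and only the additive noise remains. *)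
Lemma lyapunov_drift a (z b c : 'cV[R]_N) : 0 <= a ->
  8 * (vB + eta ^+ 2 * vB2) <= a * eta ^+ 2 * lam ->
  (\int[P]_w \int[P]_w' (lyapunov a (state_step (J w) (h w') (z, b, c)))%:E
    <= (lyapunov a (z, b, c) + (4 + a * eta ^+ 2) * (3 / 2 * vg))%:E)%E.
Proof.
move=> a0 a_lam.
pose p w := z - eta *: (J w *m z) - eta ^+ 2 *: (S w *m z).
pose x w := (J w - Jm) *m z; pose y w := (S w - Sm) *m z.
pose b' w := b + (x w + eta *: y w).
pose psi w := 2 * dot (b' w) (b' w) + 4 * dot c c + a * dot (p w) (p w)
     + (4 + a * eta ^+ 2) * noise_var (J w).
have inner w : (\int[P]_w' (lyapunov a (state_step (J w) (h w') (z, b, c)))%:E =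
    (psi w)%:E)%E.
  by have [_ ->] := lyapunov_noise_mean a z b c (J_skew w).
under eq_integral do rewrite inner.
have mx : mx_mean P (fun w => J w - Jm) 0.
  by have := mx_meanB J_mean (mx_mean_cst P Jm); rewrite subrr.
have my : mx_mean P (fun w => S w - Sm) 0.
  by have := mx_meanB S_mean (mx_mean_cst P Sm); rewrite subrr.
have mx1 : has_mean P (fun w => dot b (x w)) 0.
  by have := mx_mean_dot b z mx; rewrite mul0mx dot0r.
have my1 : has_mean P (fun w => dot b (y w)) 0.
  by have := mx_mean_dot b z my; rewrite mul0mx dot0r.
have mx2 : has_mean P (fun w => dot (x w) (x w)) (dot z (VJ *m z)).
  have := mx_mean_dot z z VJ_mean.
  by under [X in has_mean _ X]eq_fun do rewrite dot_gram.
have my2 : has_mean P (fun w => dot (y w) (y w)) (dot z (VS *m z)).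
  apply: has_mean_ext (mx_mean_dot z z VS_mean) _ erefl => w.
  rewrite -mulmxA dot_mulmx; congr (dot _ _).
  by rewrite linearB /= tr_gram Sm_sym.
have mp : has_mean P (fun w => dot (p w) (p w))
    (dot z z - eta ^+ 2 * dot z (Sm *m z) + eta ^+ 4 * dot z (S2m *m z)).
  apply: has_mean_ext (has_meanD (has_meanD (has_mean_cst P (dot z z))
    (has_meanZ (- eta ^+ 2) (mx_mean_dot z z S_mean)))
    (has_meanZ (eta ^+ 4) (mx_mean_dot z z S2_mean))) _ _.
    by move=> w; rewrite dot_skew_drift// mulNr.
  by rewrite mulNr.
have [mn nle] := noise_var_le.
(* Splitting the square of the increment avoids the mixed mean of x and y. *)
pose psi' w := 2 * (dot b b + 2 * dot b (x w) + (2 * eta) * dot b (y w)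
    + 2 * dot (x w) (x w) + 2 * eta ^+ 2 * dot (y w) (y w))
    + 4 * dot c c + a * dot (p w) (p w) + (4 + a * eta ^+ 2) * noise_var (J w).
have psi_le w : psi w <= psi' w.
  rewrite /psi /psi' !lerD2r ler_pM2l//.
  have := dot_sumD (x w) (eta *: y w).
  rewrite /b' !(dotDl _ (x w)) !dot_lin (dotC (x w) b) (dotC (y w) b) => hh.
  have e : 2 * (eta * (eta * dot (y w) (y w))) = 2 * eta ^+ 2 * dot (y w) (y w) by ring.
  rewrite e in hh; lra.
have mpsi' := has_meanD (has_meanD (has_meanD (has_meanZ 2
  (has_meanD (has_meanD (has_meanD (has_meanD (has_mean_cst P (dot b b))
    (has_meanZ 2 mx1)) (has_meanZ (2 * eta) my1)) (has_meanZ 2 mx2))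
    (has_meanZ (2 * eta ^+ 2) my2))) (has_mean_cst P (4 * dot c c)))
  (has_meanZ a mp)) (has_meanZ (4 + a * eta ^+ 2) mn).
have nv0 w : 0 <= noise_var (J w).
  have [_ qq] := noise_mean (J_skew w).
  by apply: has_mean_ge0 qq _ => w'; exact: dot_ge0.
have psi0 w : 0 <= psi w.
  have ae : 0 <= 4 + a * eta ^+ 2 by rewrite addr_ge0// mulr_ge0// sqr_ge0.
  by rewrite /psi addr_ge0 ?addr_ge0// mulr_ge0 ?dot_ge0.
have mpsi : measurable_fun setT (fun w => (psi w)%:E).
  have mS : measurable_fun setT S by exact: measurable_mulmx (measurable_trmx J_meas) J_meas.
  have mc k (v : 'cV[R]_k) : measurable_fun setT (fun _ : T => v) by exact: measurable_cst.
  have mM (v : 'M[R]_N) : measurable_fun setT (fun _ : T => v) by exact: measurable_cst.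
  have mb' : measurable_fun setT b'.
    apply: measurable_mxD => //; apply: measurable_mxD.
      by apply: measurable_mulmx => //; exact: measurable_mxB.
    by apply: measurable_mxZ; apply: measurable_mulmx => //; exact: measurable_mxB.
  have mp' : measurable_fun setT p.
    apply: measurable_mxB; last by apply: measurable_mxZ; exact: measurable_mulmx.
    by apply: measurable_mxB => //; apply: measurable_mxZ; exact: measurable_mulmx.
  apply/measurable_EFinP; apply: measurable_funD.
    apply: measurable_funD; last by apply: measurable_funM => //; exact: measurable_dot.
    by apply: measurable_funD => //; apply: measurable_funM => //; exact: measurable_dot.
  by apply: measurable_funM => //; apply/measurable_EFinP; exact: measurable_int mn.1.
apply: (@le_trans _ _ (\int[P]_w (psi' w)%:E)%E).
  apply: ge0_le_integral => //.
  - by move=> w _; rewrite lee_fin.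
  - exact: measurable_int mpsi'.1.
  - by move=> w _; rewrite lee_fin; exact: psi_le.
rewrite mpsi'.2 lee_fin /lyapunov /=.
set Z := dot z z in a_lam *; set Q := dot z (Sm *m z).
have q1 : eta ^+ 4 * dot z (S2m *m z) <= eta ^+ 2 / 2 * Q.
  have r1 : eta ^+ 4 * dot z (S2m *m z) <= eta ^+ 4 * (rho * Q).
    by rewrite ler_wpM2l ?S2_le// exprn_even_ge0.
  have r2 : eta ^+ 2 * Q * (2 * (eta ^+ 2 * rho)) <= eta ^+ 2 * Q * 1.
    by rewrite ler_wpM2l// mulr_ge0 ?sqr_ge0 ?Sm_quadratic_ge0.
  have e : eta ^+ 2 * Q * (2 * (eta ^+ 2 * rho)) = 2 * (eta ^+ 4 * (rho * Q)) by ring.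
  rewrite e in r2; lra.
have q2 : eta ^+ 2 / 2 * (lam * Z) <= eta ^+ 2 / 2 * Q.
  by rewrite ler_wpM2l ?S_ge// divr_ge0 ?sqr_ge0.
have q3 : a * (dot z z - eta ^+ 2 * dot z (Sm *m z) + eta ^+ 4 * dot z (S2m *m z))
    <= a * (Z - eta ^+ 2 / 2 * (lam * Z)).
  by rewrite ler_wpM2l// -/Z -/Q; lra.
have q4 : 8 * (vB + eta ^+ 2 * vB2) * Z <= a * eta ^+ 2 * lam * Z.
  by rewrite ler_wpM2r ?dot_ge0.
have q5 : 2 * eta ^+ 2 * dot z (VS *m z) <= 2 * eta ^+ 2 * (vB2 * Z).
  by rewrite ler_wpM2l ?VS_le// mulr_ge0 ?sqr_ge0.
have q6 := VJ_le z.
have q7 : (4 + a * eta ^+ 2) * (\tr H + eta ^+ 2 * \tr (Sm *m H)) <=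
    (4 + a * eta ^+ 2) * (3 / 2 * vg).
  by rewrite ler_wpM2l// addr_ge0// mulr_ge0// sqr_ge0.
have e1 : a * (Z - eta ^+ 2 / 2 * (lam * Z)) = a * Z - (a * eta ^+ 2 * lam * Z) / 2.
  by field.
have e2 : 8 * (vB + eta ^+ 2 * vB2) * Z = 8 * (vB * Z) + 8 * (eta ^+ 2 * (vB2 * Z)) by ring.
have e3 : 2 * eta ^+ 2 * (vB2 * Z) = 2 * (eta ^+ 2 * (vB2 * Z)) by ring.
rewrite e1 in q3; rewrite e2 in q4; rewrite e3 in q5; rewrite -/Z in q6; rewrite -/Z -/Q in q3.
rewrite !mulr0; lra.
Qed.

End skew_extragradient.

(** * Block matrices of the bilinear game *)

Section blocks.
Context {R : realType} {n : nat}.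
Implicit Types (B : 'M[R]_n) (x y : 'cV[R]_n).

Definition saddle B : 'M[R]_(n + n) := block_mx 0 B (- B^T) 0.

(** The sign comes from the ascent step in y. *)
Definition saddle_noise (s : sample R n n) : 'cV[R]_(n + n) :=
  col_mx (sgx s) (- sgy s).

Lemma saddle_skew B : (saddle B)^T = - saddle B.
Proof.
by rewrite /saddle tr_block_mx opp_block_mx !trmx0 !oppr0 linearN /= trmxK opprK.
Qed.

Lemma saddleB B C : saddle B - saddle C = saddle (B - C).
Proof.
rewrite /saddle opp_block_mx add_block_mx !oppr0 !addr0 linearB /=.
by rewrite opprK opprB [- B^T + _]addrC.
Qed.

Lemma gram_saddle B : gram (saddle B) = block_mx (B *m B^T) 0 0 (B^T *m B).
Proof.
rewrite /gram saddle_skew /saddle opp_block_mx opprK mulmx_block !oppr0.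
by rewrite !mul0mx !mulmx0 !addr0 !add0r mulNmx mulmxN opprK.
Qed.

Lemma diag_block_mul (A C D E : 'M[R]_n) :
  block_mx A 0 0 C *m block_mx D 0 0 E = block_mx (A *m D) 0 0 (C *m E).
Proof. by rewrite mulmx_block !mul0mx !mulmx0 !addr0 !add0r. Qed.

Lemma diag_blockB (A C D E : 'M[R]_n) :
  block_mx A 0 0 C - block_mx D 0 0 E = block_mx (A - D) 0 0 (C - E).
Proof. by rewrite opp_block_mx add_block_mx !oppr0 !addr0. Qed.

Lemma dot_col x y (u v : 'cV[R]_n) :
  dot (col_mx x y) (col_mx u v) = dot x u + dot y v.
Proof. by rewrite /dot tr_col_mx mul_row_col mxE. Qed.

Lemma dot_diag_block (A C : 'M[R]_n) x y :
  dot (col_mx x y) (block_mx A 0 0 C *m col_mx x y) =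
  dot x (A *m x) + dot y (C *m y).
Proof. by rewrite mul_block_col !mul0mx addr0 add0r dot_col. Qed.

(** With the primal and dual variables stacked, the extragradient map is the one of a skew
    linear operator. *)
Lemma seg_step_skew eta (s : sample R n n) x y :
  col_mx (seg_step eta s (x, y)).1 (seg_step eta s (x, y)).2 =
  skew_step eta (saddle (sB s)) (saddle_noise s) (col_mx x y).
Proof.
rewrite /skew_step /seg_step /saddle /saddle_noise /=.
rewrite mul_block_col !mul0mx add0r addr0 add_col_mx.
rewrite scale_col_mx opp_col_mx add_col_mx mul_block_col !mul0mx add0r addr0.
rewrite add_col_mx scale_col_mx opp_col_mx add_col_mx.
by rewrite !mulNmx -!opprD !scalerN !opprK.
Qed.

Lemma forall_col_mx (Q : 'cV[R]_(n + n) -> Prop) :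
  (forall x y, Q (col_mx x y)) -> forall z, Q z.
Proof. by move=> QQ z; rewrite -[z]vsubmxK; exact: QQ. Qed.

End blocks.

Section definite_matrices.
Context {R : realType} {n : nat}.
Implicit Types A M E B : 'M[R]_n.

Lemma unitmx_kernel A : (forall x : 'cV[R]_n, A *m x = 0 -> x = 0) -> A \in unitmx.
Proof.
move=> Ainj; rewrite -unitmx_tr -row_free_unit -kermx_eq0.
apply/negP => /negP /rowV0Pn[v /sub_kermxP vA].
rewrite -[v]trmxK (Ainj v^T) ?trmx0 ?eqxx//.
by rewrite -[A]trmxK -trmx_mul vA trmx0.
Qed.

Lemma unitmx_injective A (x : 'cV[R]_n) : A \in unitmx -> A *m x = 0 -> x = 0.
Proof. by move=> uA Ax; rewrite -[x](mulKmx uA) Ax mulmx0. Qed.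

Lemma posdef_unitmx M lam : 0 < lam ->
  (forall x, lam * dot x x <= dot x (M *m x)) -> M \in unitmx.
Proof.
move=> lam0 Mge; apply: unitmx_kernel => x Mx; apply: dot_eq0.
apply/eqP; rewrite eq_le dot_ge0 andbT -(pmulr_rle0 _ lam0).
by apply: le_trans (Mge x) _; rewrite Mx dot0r.
Qed.

(** After the substitution x = M^(-1/2) y, comparing E with M is the Rayleigh bound for
    M^(-1/2) E M^(-1/2). *)
Lemma relative_lambda_max M E lam : (0 < n)%N -> 0 < lam ->
  M^T = M -> E^T = E -> (forall x, lam * dot x x <= dot x (M *m x)) ->
  forall x, dot x (E *m x) <=
    lambda_max (invmx (sqrtmx M) *m E *m invmx (sqrtmx M)) * dot x (M *m x).
Proof.
move=> n0 lam0 Ms Es Mge x.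
have [ss sM] : (sqrtmx M)^T = sqrtmx M /\ sqrtmx M *m sqrtmx M = M.
  apply: sqrtmxP; split => // y; rewrite -mulmxA.
  by apply: le_trans (Mge y); rewrite mulr_ge0 ?dot_ge0// ltW.
have us : sqrtmx M \in unitmx.
  by have := posdef_unitmx lam0 Mge; rewrite -{1}sM unitmx_mul => /andP[].
have Cs : (invmx (sqrtmx M) *m E *m invmx (sqrtmx M))^T =
    invmx (sqrtmx M) *m E *m invmx (sqrtmx M).
  by rewrite !trmx_mul trmx_inv ss Es mulmxA.
have [_ /(_ (sqrtmx M *m x))] := lambda_maxP n0 Cs.
have eM : dot (sqrtmx M *m x) (sqrtmx M *m x) = dot x (M *m x).
  by rewrite -[in RHS]sM -mulmxA [RHS]dot_mulmx ss.
by rewrite -!mulmxA mulKmx// [leLHS]dot_mulmx trmx_inv ss mulKmx// eM.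
Qed.

(** If v is a left eigenvector of B^T B then v B^T is one of B B^T, nonzero as B is
    invertible. *)
Lemma eigenvalue_gramC B a : B \in unitmx ->
  eigenvalue (B^T *m B) a -> eigenvalue (B *m B^T) a.
Proof.
move=> uB /eigenvalueP[v vB v0]; apply/eigenvalueP; exists (v *m B^T).
  by rewrite -!mulmxA [B^T *m (_ *m _)]mulmxA mulmxA vB scalemxAl.
apply: contra v0 => /eqP vB0.
by rewrite -[v](mulmxK (_ : B^T \in unitmx)) ?unitmx_tr// vB0 mul0mx.
Qed.

Lemma gram_bounds B : (0 < n)%N -> B \in unitmx ->
  let mu := lambda_min (B *m B^T) in
  [/\ 0 < mu, mu <= lambda_max (B^T *m B),
      forall x, mu * dot x x <= dot (B^T *m x) (B^T *m x) &
      forall y, mu * dot y y <= dot (B *m y) (B *m y)].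
Proof.
move=> n0 uB mu.
have s1 : (B *m B^T)^T = B *m B^T by rewrite trmx_mul trmxK.
have s2 : (B^T *m B)^T = B^T *m B by rewrite trmx_mul trmxK.
have [ev1 ge1] := lambda_minP n0 s1.
have [ev2 ge2] := lambda_minP n0 s2.
have [_ le3] := lambda_maxP n0 s2.
have q1 x : dot x (B *m B^T *m x) = dot (B^T *m x) (B^T *m x).
  by rewrite -mulmxA dot_mulmx.
have q2 y : dot y (B^T *m B *m y) = dot (B *m y) (B *m y).
  by rewrite -mulmxA dot_mulmx trmxK.
have [x xp ex] := eigenvalue_quadratic ev1.
have [y yp ey] := eigenvalue_quadratic (eigenvalue_gramC uB ev2).
have mule : mu <= lambda_min (B^T *m B).
  by rewrite -(ler_pM2r yp) -ey; exact: (ge1 y).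
have geB z : mu * dot z z <= dot (B *m z) (B *m z).
  by rewrite -q2; apply: le_trans (ge2 z); rewrite ler_wpM2r// dot_ge0.
split; [| |by move=> z; rewrite -q1|exact: geB].
- rewrite -(pmulr_lgt0 _ xp) -ex q1 lt_def dot_ge0 andbT.
  apply: contraTneq xp => /dot_eq0 Bx; rewrite (unitmx_injective _ Bx) ?unitmx_tr//.
  by rewrite dot0r ltxx.
- by rewrite -(ler_pM2r xp); apply: le_trans (geB x) _; rewrite -q2.
Qed.

End definite_matrices.

Section square_integrable.
Context {R : realType} d (T : measurableType d) (P : probability T R).

Lemma mx_mean_mx_expectation m n (X : T -> 'M[R]_(m, n)) M :
  mx_mean P X M -> mx_mean P X (mx_expectation P X).
Proof. by move=> XM; apply: mx_mean_expectation => i j; exact: (XM i j).1. Qed.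

(** Domination by 1 + |h|^2 and by |h|^2. *)
Lemma square_integrable_means n (h : T -> 'cV[R]_n) :
  measurable_fun setT h ->
  P.-integrable setT (fun w => (dot (h w) (h w))%:E) ->
  mx_integrable P h /\ mx_integrable P (fun w => h w *m (h w)^T).
Proof.
move=> mh ih.
have sqle w i : h w i 0 ^+ 2 <= dot (h w) (h w).
  rewrite dotE (bigD1 i)//= expr2 lerDl.
  by apply: sumr_ge0 => j _; rewrite -expr2 sqr_ge0.
have /measurable_mxP mhE := mh.
split=> i j.
  apply: (le_integrable measurableT (g := fun w => (1 + dot (h w) (h w))%:E)).
  - exact/measurable_EFinP.
  - move=> w _; rewrite ord1 /= lee_fin.
    have hi := sqle w i; have := normr_ge0 (h w i 0).
    rewrite (ger0_norm (_ : 0 <= 1 + _)) ?addr_ge0 ?dot_ge0//.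
    rewrite -(real_normK (num_real (h w i 0))) in hi.
    have := sqr_ge0 (`|h w i 0| - 1); rewrite sqrrB1; lra.
  - under eq_fun do rewrite EFinD; apply: integrableD => //.
    exact: finite_measure_integrable_cst.
apply: (le_integrable measurableT (g := fun w => (dot (h w) (h w))%:E)) => //.
- apply/measurable_EFinP; under eq_fun do rewrite mxE big_ord1 mxE.
  exact: measurable_funM.
- move=> w _; rewrite /= lee_fin mxE big_ord1 mxE ord1.
  rewrite [leRHS]ger0_norm ?dot_ge0// normrM.
  have hi := sqle w i; have hj := sqle w j.
  rewrite -(real_normK (num_real (h w i 0))) in hi.
  rewrite -(real_normK (num_real (h w j 0))) in hj.
  have := sqr_ge0 (`|h w i 0| - `|h w j 0|); rewrite sqrrB; lra.
Qed.

End square_integrable.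

(** * Moments of one sample *)

Section stacked_noise.
Context {R : realType} {n : nat} d (T : measurableType d) (P : probability T R).
Variables (xi : {RV P >-> sample R n n}) (sigB sigB2 sigg : R).

Definition stacked_gram_mean : 'M[R]_(n + n) := block_mx (Mmean xi) 0 0 (Mhmean xi).

Let J w := saddle (Bxi xi w).
Let S w := gram (J w).
Let SE w : S w = block_mx (Mxi xi w) 0 0 (Mhxi xi w).
Proof. by rewrite /S gram_saddle. Qed.

Let SfunE : S = fun w => block_mx (Mxi xi w) 0 0 (Mhxi xi w).
Proof. by apply/funext => w; exact: SE. Qed.

Hypothesis noiseB : bilinear_noise xi sigB sigB2.

Lemma Bmean_mean : mx_mean P (Bxi xi) (Bmean xi).
Proof. by have [[h _ _] _ _ _ _] := noiseB; exact: mx_mean_expectation. Qed.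

Lemma Mmean_mean : mx_mean P (Mxi xi) (Mmean xi).
Proof. by have [[_ h _] _ _ _ _] := noiseB; exact: mx_mean_expectation. Qed.

Lemma Mhmean_mean : mx_mean P (Mhxi xi) (Mhmean xi).
Proof. by have [[_ _ h] _ _ _ _] := noiseB; exact: mx_mean_expectation. Qed.

Lemma Mmean_sym : (Mmean xi)^T = Mmean xi.
Proof.
apply: mx_mean_unique (mx_mean_tr Mmean_mean) _.
have -> : (fun w => (Mxi xi w)^T) = Mxi xi; last exact: Mmean_mean.
by apply/funext => w; rewrite /Mxi trmx_mul trmxK.
Qed.

Lemma Mhmean_sym : (Mhmean xi)^T = Mhmean xi.
Proof.
apply: mx_mean_unique (mx_mean_tr Mhmean_mean) _.
have -> : (fun w => (Mhxi xi w)^T) = Mhxi xi; last exact: Mhmean_mean.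
by apply/funext => w; rewrite /Mhxi trmx_mul trmxK.
Qed.

Lemma saddle_mean : mx_mean P J (saddle (Bmean xi)).
Proof.
by apply: mx_mean_block; [exact: mx_mean_cst|exact: Bmean_mean|
  apply: mx_meanN; apply: mx_mean_tr; exact: Bmean_mean|exact: mx_mean_cst].
Qed.

Lemma mx_mean_diag k l (A : T -> 'M[R]_k) (C : T -> 'M[R]_l) a c :
  mx_mean P A a -> mx_mean P C c ->
  mx_mean P (fun w => block_mx (A w) 0 0 (C w)) (block_mx a 0 0 c).
Proof. by move=> Aa Cc; apply: mx_mean_block => //; exact: mx_mean_cst. Qed.

Lemma saddle_gram_mean : mx_mean P S stacked_gram_mean.
Proof.
rewrite SfunE.
exact: mx_mean_diag Mmean_mean Mhmean_mean.
Qed.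

(** The second moment of a square-integrable random matrix is recovered from the variance. *)
Lemma mx_mean_sqr k (X : T -> 'M[R]_k) M V :
  mx_mean P X M -> mx_mean P (fun w => (X w - M) *m (X w - M)) V ->
  mx_mean P (fun w => X w *m X w) (mx_expectation P (fun w => X w *m X w)).
Proof.
move=> XM XV; apply: (@mx_mean_mx_expectation _ _ _ _ _ _ _ (V + M *m M + M *m M - M *m M)).
have -> : (fun w => X w *m X w) = (fun w =>
    (X w - M) *m (X w - M) + M *m X w + X w *m M - M *m M).
  apply/funext => w; rewrite mulmxBr !mulmxBl opprB.
  by apply/matrixP => i j; rewrite !mxE; ring.
apply: mx_meanB; last exact: mx_mean_cst.
apply: mx_meanD; last exact: mx_mean_mulmxr.
by apply: mx_meanD => //; exact: mx_mean_mulmxl.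
Qed.

Lemma Mxi_sqr_mean : mx_mean P (fun w => Mxi xi w *m Mxi xi w)
  (mx_expectation P (fun w => Mxi xi w *m Mxi xi w)).
Proof.
have [_ _ _ _ [_ [h _]]] := noiseB.
exact: mx_mean_sqr Mmean_mean (mx_mean_expectation h).
Qed.

Lemma Mhxi_sqr_mean : mx_mean P (fun w => Mhxi xi w *m Mhxi xi w)
  (mx_expectation P (fun w => Mhxi xi w *m Mhxi xi w)).
Proof.
have [_ _ _ _ [[h _] _]] := noiseB.
exact: mx_mean_sqr Mhmean_mean (mx_mean_expectation h).
Qed.

Definition stacked_sqr_mean : 'M[R]_(n + n) :=
  block_mx (mx_expectation P (fun w => Mxi xi w *m Mxi xi w)) 0 0
           (mx_expectation P (fun w => Mhxi xi w *m Mhxi xi w)).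

Lemma saddle_sqr_mean : mx_mean P (fun w => S w *m S w) stacked_sqr_mean.
Proof.
rewrite SfunE; under [X in mx_mean _ X]eq_fun do rewrite diag_block_mul.
exact: mx_mean_diag Mxi_sqr_mean Mhxi_sqr_mean.
Qed.

Definition stacked_var : 'M[R]_(n + n) :=
  block_mx (mx_expectation P (fun w => (Bxi xi w - Bmean xi) *m (Bxi xi w - Bmean xi)^T))
    0 0 (mx_expectation P (fun w => (Bxi xi w - Bmean xi)^T *m (Bxi xi w - Bmean xi))).

Lemma saddle_var_mean :
  mx_mean P (fun w => gram (J w - saddle (Bmean xi))) stacked_var.
Proof.
under [X in mx_mean _ X]eq_fun do rewrite saddleB gram_saddle.
have [_ _ _ [[h1 _] [h2 _]] _] := noiseB.
by apply: mx_mean_diag; exact: mx_mean_expectation.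
Qed.

Lemma saddle_var_le z : dot z (stacked_var *m z) <= sigB ^+ 2 * dot z z.
Proof.
have [_ _ _ [[_ h1] [_ h2]] _] := noiseB.
move: z; apply: forall_col_mx => x y; rewrite dot_diag_block dot_col mulrDr.
by rewrite lerD// opnorm_quadratic.
Qed.

Definition stacked_gram_var : 'M[R]_(n + n) :=
  block_mx (mx_expectation P (fun w => (Mxi xi w - Mmean xi) *m (Mxi xi w - Mmean xi)))
    0 0 (mx_expectation P (fun w => (Mhxi xi w - Mhmean xi) *m (Mhxi xi w - Mhmean xi))).

Lemma saddle_gram_var_mean :
  mx_mean P (fun w => (S w - stacked_gram_mean) *m (S w - stacked_gram_mean))
    stacked_gram_var.
Proof.
rewrite SfunE; under [X in mx_mean _ X]eq_fun do rewrite diag_blockB diag_block_mul.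
have [_ _ _ _ [[h1 _] [h2 _]]] := noiseB.
by apply: mx_mean_diag; exact: mx_mean_expectation.
Qed.

Lemma saddle_gram_var_le z :
  dot z (stacked_gram_var *m z) <= sigB2 ^+ 2 * dot z z.
Proof.
have [_ _ _ _ [[_ h1] [_ h2]]] := noiseB.
move: z; apply: forall_col_mx => x y; rewrite dot_diag_block dot_col mulrDr.
by rewrite lerD// opnorm_quadratic.
Qed.

Lemma dim_gt0 : (0 < n)%N.
Proof.
have [_ [h _] _ _ _] := noiseB; rewrite lt0n; apply/negP => /eqP n0.
move: h; rewrite /lambda_max (_ : [set a | _] = set0) ?sup0 ?ltxx//.
apply/seteqP; split => // a /= /eigenvalueP[v _ /eqP]; case.
by apply/matrixP => i j; have := ltn_ord j; rewrite {2}n0.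
Qed.

Let ge_minlr (a b : R) : Num.min a b <= a /\ Num.min a b <= b.
Proof. by rewrite !ge_min !lexx orbT. Qed.

Lemma Mmean_ge x : lambda_min_M xi * dot x x <= dot x (Mmean xi *m x).
Proof.
have [_ le] := lambda_minP dim_gt0 Mmean_sym.
apply: le_trans (le x); apply: ler_wpM2r; first exact: dot_ge0.
exact: (ge_minlr _ _).1.
Qed.

Lemma Mhmean_ge x : lambda_min_M xi * dot x x <= dot x (Mhmean xi *m x).
Proof.
have [_ le] := lambda_minP dim_gt0 Mhmean_sym.
apply: le_trans (le x); apply: ler_wpM2r; first exact: dot_ge0.
exact: (ge_minlr _ _).2.
Qed.

Lemma stacked_gram_mean_ge z :
  lambda_min_M xi * dot z z <= dot z (stacked_gram_mean *m z).
Proof.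
move: z; apply: forall_col_mx => x y; rewrite dot_diag_block dot_col mulrDr.
by rewrite lerD ?Mmean_ge ?Mhmean_ge.
Qed.

Let rho := Num.max (rho1 xi) (rho2 xi).

(** This is what the step size eta_M is designed for: the maximum of rho1 and rho2 is the
    least factor by which the second moment of the Gram matrices is dominated by their
    mean, on both blocks. *)
Lemma stacked_sqr_mean_le z :
  dot z (stacked_sqr_mean *m z) <= rho * dot z (stacked_gram_mean *m z).
Proof.
have [_ [_ lam0] _ _ _] := noiseB.
have sq1 : (mx_expectation P (fun w => Mxi xi w *m Mxi xi w))^T =
    mx_expectation P (fun w => Mxi xi w *m Mxi xi w).
  apply: mx_mean_unique (mx_mean_tr Mxi_sqr_mean) _.
  have -> : (fun w => (Mxi xi w *m Mxi xi w)^T) = (fun w => Mxi xi w *m Mxi xi w).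
    by apply/funext => w; rewrite /Mxi !trmx_mul !trmxK.
  exact: Mxi_sqr_mean.
have sq2 : (mx_expectation P (fun w => Mhxi xi w *m Mhxi xi w))^T =
    mx_expectation P (fun w => Mhxi xi w *m Mhxi xi w).
  apply: mx_mean_unique (mx_mean_tr Mhxi_sqr_mean) _.
  have -> : (fun w => (Mhxi xi w *m Mhxi xi w)^T) = (fun w => Mhxi xi w *m Mhxi xi w).
    by apply/funext => w; rewrite /Mhxi !trmx_mul !trmxK.
  exact: Mhxi_sqr_mean.
move: z; apply: forall_col_mx => x y; rewrite !dot_diag_block mulrDr.
have nonneg (A : 'M[R]_n) v : lambda_min_M xi * dot v v <= dot v (A *m v) ->
    0 <= dot v (A *m v).
  by apply: le_trans; rewrite mulr_ge0 ?dot_ge0// ltW.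
have le_maxlr (a b : R) : a <= Num.max a b /\ b <= Num.max a b.
  by rewrite !le_max !lexx orbT.
have [r1 r2] := le_maxlr (rho1 xi) (rho2 xi).
apply: lerD.
  apply: le_trans (ler_wpM2r (nonneg _ _ (Mmean_ge x)) r1).
  exact: relative_lambda_max dim_gt0 lam0 Mmean_sym sq1 Mmean_ge x.
apply: le_trans (ler_wpM2r (nonneg _ _ (Mhmean_ge y)) r2).
exact: relative_lambda_max dim_gt0 lam0 Mhmean_sym sq2 Mhmean_ge y.
Qed.

(** For z != 0, 0 < |E S z|^2 <= E |S z|^2 <= rho z . (E S) z. *)
Lemma rho_gt0 : 0 < rho.
Proof.
have [_ [_ lam0] _ _ _] := noiseB.
have [_ le] := lambda_minP dim_gt0 Mmean_sym.
have [x xp _] := eigenvalue_quadratic (lambda_minP dim_gt0 Mmean_sym).1.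
pose z : 'cV[R]_(n + n) := col_mx x 0.
have zp : 0 < dot z z by rewrite dot_col dot0r addr0.
have h1 := stacked_gram_mean_ge z.
have h2 := Sm_sqr_le saddle_gram_mean saddle_sqr_mean z.
have h3 := stacked_sqr_mean_le z.
have q0 : 0 < dot z (stacked_gram_mean *m z).
  by apply: lt_le_trans h1; rewrite mulr_gt0.
rewrite -(pmulr_lgt0 _ q0); apply: lt_le_trans h3; apply: lt_le_trans h2.
rewrite lt_def dot_ge0 andbT; apply: contraTneq q0 => /dot_eq0 ->.
by rewrite dot0r ltxx.
Qed.

Hypothesis noiseg : intercept_noise xi sigg.

Let h w := saddle_noise (xi w).

Lemma measurable_sample :
  [/\ measurable_fun setT (Bxi xi), measurable_fun setT (gxxi xi) &
      measurable_fun setT (gyxi xi)].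
Proof.
have mxi : measurable_fun setT xi by exact: measurable_funPT.
split.
- exact: (measurableT_comp measurable_fst (measurableT_comp measurable_fst mxi)).
- exact: (measurableT_comp measurable_snd (measurableT_comp measurable_fst mxi)).
- exact: (measurableT_comp measurable_snd mxi).
Qed.

Lemma measurable_stacked_noise : measurable_fun setT h.
Proof.
have [_ mx my] := measurable_sample.
apply: measurable_col_mx => //.
under eq_fun do rewrite -scaleN1r; exact: measurable_mxZ.
Qed.

Lemma dot_stacked_noise w :
  dot (h w) (h w) = enorm (gxxi xi w) ^+ 2 + enorm (gyxi xi w) ^+ 2.
Proof. by rewrite dot_col !dotNl !dotNr opprK !enormE. Qed.

Lemma stacked_noise_means :
  exists H, [/\ mx_mean P h 0, mx_mean P (fun w => h w *m (h w)^T) H &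
                \tr H <= sigg ^+ 2].
Proof.
have [_ var gx0 gy0 _] := noiseg.
have le_var : (\int[P]_w (dot (h w) (h w))%:E <= (sigg ^+ 2)%:E)%E.
  move: var; rewrite unlock.
  by under [X in (X <= _)%E -> _]eq_integral do rewrite -dot_stacked_noise.
have mh := measurable_stacked_noise.
have ih : P.-integrable setT (fun w => (dot (h w) (h w))%:E).
  apply/integrableP; split; first by apply/measurable_EFinP; exact: measurable_dot.
  under eq_integral do rewrite gee0_abs ?lee_fin ?dot_ge0//.
  by apply: le_lt_trans le_var _; rewrite ltry.
have [hi hhi] := square_integrable_means mh ih.
have hm := mx_mean_expectation hi; have hhm := mx_mean_expectation hhi.
exists (mx_expectation P (fun w => h w *m (h w)^T)); split => //.
  have gxm : mx_mean P (gxxi xi) (usubmx (mx_expectation P h)).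
    move=> i j; apply: has_mean_ext (hm (lshift n i) j) _ _ => [w|].
      by rewrite /h /saddle_noise col_mxEu.
    by rewrite [LHS]mxE.
  have gym : mx_mean P (gyxi xi) (- dsubmx (mx_expectation P h)).
    move=> i j; apply: has_mean_ext (has_meanZ (-1) (hm (rshift n i) j)) _ _ => [w|].
      by rewrite /h /saddle_noise col_mxEd mxE mulN1r opprK.
    by rewrite mxE mulN1r [X in - X]mxE.
  have := mx_mean_col (mx_mean_mx_expectation gxm) (mx_meanN (mx_mean_mx_expectation gym)).
  by rewrite gx0 gy0 oppr0 col_mx0.
have [_ trE] := mx_mean_tr_mul 1%:M hhm.
rewrite mul1mx in trE; rewrite -lee_fin -trE.
by under eq_integral do rewrite mul1mx -dot_trace1.
Qed.

End stacked_noise.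

(** * Averaged iterates *)

Section averaging.
Context {R : realType} {N : nat}.
Variables (Jm Sm : 'M[R]_N) (eta : R) (A : nat -> 'M[R]_N) (g : nat -> 'cV[R]_N).
Variables (s : nat -> 'cV[R]_N * 'cV[R]_N * 'cV[R]_N) (z0 : 'cV[R]_N).
Hypothesis A_skew : forall t, (A t)^T = - A t.
Hypothesis s0 : s 0%N = (z0, 0, 0).
Hypothesis sS : forall t, s t.+1 = state_step Jm Sm eta (A t) (g t) (s t).

(** Each step of z is - eta times the mean field at z, up to the two noises that b and c
    record. *)
Lemma telescope_mean_field k :
  eta *: ((Jm + eta *: Sm) *m \sum_(0 <= t < k) (s t).1.1) =
  z0 - (s k).1.1 - eta *: (s k).1.2 - eta *: (s k).2.
Proof.
elim: k => [|k IH].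
  by rewrite big_geq// s0 /= mulmx0 !scaler0 !subrr.
rewrite big_nat_recr//= mulmxDr scalerDr IH sS.
case: (s k) => [[z b] c] /=; rewrite skew_stepE//.
rewrite mulmxDl -scalemxAl !mulmxBl.
move: (Jm *m z) (Sm *m z) (A k *m z) (gram (A k) *m z) (A k *m g k) => u v a q w.
by apply/matrixP => i j; rewrite !mxE; ring.
Qed.

(** By telescoping, eta times the mean field at the sum is (z0 - z) - eta b - eta c; the square
    norm is split as 2 |eta b|^2 + 4 |eta c|^2 + 8 |z0|^2 + 8 |z|^2. *)
Lemma sum_le_lyapunov a c k : 0 < eta -> 8 <= a * eta ^+ 2 ->
  (forall v, c * dot v v <= dot ((Jm + eta *: Sm) *m v) ((Jm + eta *: Sm) *m v)) ->
  c * dot (\sum_(0 <= t < k) (s t).1.1) (\sum_(0 <= t < k) (s t).1.1) <=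
    lyapunov a (s k) + 8 / eta ^+ 2 * dot z0 z0.
Proof.
move=> eta0 a8 lo; set x := \sum_(0 <= t < k) (s t).1.1.
have e2 : 0 < eta ^+ 2 by rewrite exprn_gt0.
have tel := telescope_mean_field k; rewrite -/x in tel.
have E : eta ^+ 2 * dot ((Jm + eta *: Sm) *m x) ((Jm + eta *: Sm) *m x) =
    dot (eta *: ((Jm + eta *: Sm) *m x)) (eta *: ((Jm + eta *: Sm) *m x)).
  by rewrite dotZl dotZr; ring.
rewrite -(ler_pM2l e2); apply: le_trans (ler_wpM2l (ltW e2) (lo x)) _.
rewrite E tel /lyapunov.
move: (s k) => [[z b] e] /=.
have h1 := dot_sumD (- (eta *: b)) ((z0 - z) - eta *: e).
have h2 := dot_sumD (z0 - z) (- (eta *: e)).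
have h3 := dot_sumD z0 (- z).
have -> : z0 - z - eta *: b - eta *: e = - (eta *: b) + ((z0 - z) - eta *: e).
  by rewrite [in RHS]addrCA addrA.
rewrite !(dotNl, dotNr, dotZl, dotZr, opprK) in h1 h2 h3.
have h4 : 8 * dot z z <= a * eta ^+ 2 * dot z z by rewrite ler_wpM2r ?dot_ge0.
have -> : eta ^+ 2 * (2 * dot b b + 4 * dot e e + a * dot z z + 8 / eta ^+ 2 * dot z0 z0)
   = 2 * (eta * (eta * dot b b)) + 4 * (eta * (eta * dot e e))
     + a * eta ^+ 2 * dot z z + 8 * dot z0 z0.
  by field; rewrite gt_eqF.
lra.
Qed.

End averaging.

Section measurable_step.
Context {R : realType} d (T : measurableType d).

Lemma measurable_state_step N (Jm Sm : 'M[R]_N) eta (A : T -> 'M[R]_N)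
    (g : T -> 'cV[R]_N) (s : T -> 'cV[R]_N * 'cV[R]_N * 'cV[R]_N) :
  measurable_fun setT A -> measurable_fun setT g -> measurable_fun setT s ->
  measurable_fun setT (fun w => state_step Jm Sm eta (A w) (g w) (s w)).
Proof.
move=> mA mg ms.
have -> : (fun w => state_step Jm Sm eta (A w) (g w) (s w)) = (fun w =>
    (skew_step eta (A w) (g w) (s w).1.1,
     (s w).1.2 + ((A w - Jm) *m (s w).1.1 + eta *: ((gram (A w) - Sm) *m (s w).1.1)),
     (s w).2 + (g w - eta *: (A w *m g w)))).
  by apply/funext => w; case: (s w) => [[z b] c].
have mz : measurable_fun setT (fun w => (s w).1.1).
  exact: (measurableT_comp measurable_fst (measurableT_comp measurable_fst ms)).
have mb : measurable_fun setT (fun w => (s w).1.2).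
  exact: (measurableT_comp measurable_snd (measurableT_comp measurable_fst ms)).
have mc : measurable_fun setT (fun w => (s w).2).
  exact: (measurableT_comp measurable_snd ms).
have mM (v : 'M[R]_N) : measurable_fun setT (fun _ : T => v) by exact: measurable_cst.
have mAg : measurable_fun setT (fun w => A w *m g w) by exact: measurable_mulmx.
have mgram : measurable_fun setT (fun w => gram (A w)).
  by apply: measurable_mulmx => //; exact: measurable_trmx.
apply: measurable_fun_pair; first apply: measurable_fun_pair.
- apply: measurable_mxB => //; apply: measurable_mxZ; apply: measurable_mxD => //.
  apply: measurable_mulmx => //; apply: measurable_mxB => //; apply: measurable_mxZ.
  by apply: measurable_mxD => //; exact: measurable_mulmx.
- apply: measurable_mxD => //; apply: measurable_mxD.
    by apply: measurable_mulmx => //; exact: measurable_mxB.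
  by apply: measurable_mxZ; apply: measurable_mulmx => //; exact: measurable_mxB.
- apply: measurable_mxD => //; apply: measurable_mxB => //.
  exact: measurable_mxZ.
Qed.

Lemma measurable_lyapunov N a (s : T -> 'cV[R]_N * 'cV[R]_N * 'cV[R]_N) :
  measurable_fun setT s -> measurable_fun setT (fun w => lyapunov a (s w)).
Proof.
move=> ms.
have mz : measurable_fun setT (fun w => (s w).1.1).
  exact: (measurableT_comp measurable_fst (measurableT_comp measurable_fst ms)).
have mb : measurable_fun setT (fun w => (s w).1.2).
  exact: (measurableT_comp measurable_snd (measurableT_comp measurable_fst ms)).
have mc : measurable_fun setT (fun w => (s w).2).
  exact: (measurableT_comp measurable_snd ms).
by apply: measurable_funD; [apply: measurable_funD|];
  apply: measurable_funM => //; exact: measurable_dot.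
Qed.

Lemma measurable_saddle n (B : T -> 'M[R]_n) :
  measurable_fun setT B -> measurable_fun setT (fun w => saddle (B w)).
Proof.
move=> mB; apply: measurable_block_mx; [exact: measurable_cst|by []| |exact: measurable_cst].
under eq_fun do rewrite -scaleN1r.
by apply: measurable_mxZ; exact: measurable_trmx.
Qed.

Lemma measurable_saddle_noise n (gx gy : T -> 'cV[R]_n) :
  measurable_fun setT gx -> measurable_fun setT gy ->
  measurable_fun setT (fun w => col_mx (gx w) (- gy w)).
Proof.
move=> mx my; apply: measurable_col_mx => //.
by under eq_fun do rewrite -scaleN1r; exact: measurable_mxZ.
Qed.

Lemma measurable_mx_sum (I : Type) (r : seq I) m n (f : I -> T -> 'M[R]_(m, n)) :
  (forall i, measurable_fun setT (f i)) ->
  measurable_fun setT (fun w => \sum_(i <- r) f i w).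
Proof.
move=> mf; apply/measurable_mxP => i j.
under eq_fun do rewrite summxE; apply: measurable_sum => l.
by have /measurable_mxP := mf l.
Qed.

End measurable_step.

Lemma lyapunov_ge0 (R : realType) N (a : R) (s : 'cV[R]_N * 'cV[R]_N * 'cV[R]_N) :
  0 <= a -> 0 <= lyapunov a s.
Proof. by move=> a0; rewrite /lyapunov !addr_ge0// mulr_ge0 ?dot_ge0. Qed.

Section saddle_dynamics.
Context {R : realType} {n : nat} d (T : measurableType d) (P : probability T R).
Variables (xi : {RV P >-> sample R n n}) (sigB sigB2 sigg alpha : R).
Hypotheses (noiseB : bilinear_noise xi sigB sigB2) (noiseg : intercept_noise xi sigg).
Hypothesis B_nonsingular : Bmean xi \in unitmx.
Hypotheses (alpha_gt0 : 0 < alpha) (alpha_lt1 : alpha < 1).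

Let rho := Num.max (rho1 xi) (rho2 xi).
Let eta := eta_hat xi sigB alpha.
Let mu := lambda_min (Bmean xi *m (Bmean xi)^T).
Let Jm := saddle (Bmean xi).
Let Sm := stacked_gram_mean xi.
Let kappa := kappa_zeta xi sigB sigB2 alpha.
(* Of the weight, 8 / eta^2 bounds the last iterate in the telescoped sum, and
   8 kappa / eta^2 absorbs the multiplicative noise. *)
Let a := (8 + 8 * kappa) / eta ^+ 2.

(** The two terms of the minimum give the two upper bounds; the second one uses that
    mu / sqrt L <= sqrt mu, where L is the largest eigenvalue of Bm^T Bm with Bm the mean
    of B, so that mu <= L. *)
Lemma eta_hat_bounds :
  [/\ 0 < eta, 2 * (eta ^+ 2 * rho) <= 1 &
      2 * eta * sigB ^+ 2 <= alpha * Num.sqrt mu].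
Proof.
have rho0 : 0 < rho by exact: rho_gt0 noiseB.
have n0 := dim_gt0 noiseB.
have [mu0 muL _ _] := gram_bounds n0 B_nonsingular.
rewrite -/mu in mu0 muL; set L := lambda_max _ in muL.
have L0 : 0 < L by exact: lt_le_trans muL.
have sm : 0 < Num.sqrt mu by rewrite sqrtr_gt0.
have sL : 0 < Num.sqrt L by rewrite sqrtr_gt0.
have smL : Num.sqrt mu <= Num.sqrt L by rewrite ler_wsqrtr.
set e1 := eta_M xi / Num.sqrt 2.
have e1p : 0 < e1 by rewrite /e1 /eta_M divr_gt0 ?invr_gt0 ?sqrtr_gt0.
have e1E : 2 * (e1 ^+ 2 * rho) = 1.
  rewrite /e1 /eta_M -/rho exprMn !exprVn !sqr_sqrtr ?ltW//.
  by field; rewrite gt_eqF.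
have small e : 0 < e -> e <= e1 -> 2 * (e ^+ 2 * rho) <= 1.
  move=> e0 ee1; apply: (@le_trans _ _ (2 * (e1 ^+ 2 * rho))); last by rewrite e1E.
  by rewrite ler_pM2l// ler_pM2r// ler_pXn2r// nnegrE ltW.
have sqrtE : Num.sqrt mu ^+ 2 = mu by rewrite sqr_sqrtr// ltW.
rewrite /eta /eta_hat -/e1 -/mu -/L; case: eqVneq => [->|sB0].
  by split => //; [exact: small|rewrite expr0n mulr0 mulr_ge0 ?ltW].
have sBp : 0 < sigB ^+ 2 by rewrite exprn_even_gt0.
set e2 := _ / (2 * _ * _).
have e2p : 0 < e2 by rewrite /e2 divr_gt0// mulr_gt0// mulr_gt0.
have mp : 0 < Num.min e1 e2 by rewrite lt_min e1p e2p.
split => //; first by apply: small => //; rewrite ge_min lexx.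
have h1 : 2 * Num.min e1 e2 * sigB ^+ 2 <= 2 * e2 * sigB ^+ 2.
  by rewrite ler_pM2r// ler_pM2l// ge_min lexx orbT.
apply: le_trans h1 _.
have -> : 2 * e2 * sigB ^+ 2 = alpha * (mu / Num.sqrt L).
  by rewrite /e2; field; rewrite sB0 gt_eqF.
rewrite ler_pM2l// ler_pdivrMr// -[leLHS]sqrtE expr2.
by rewrite ler_pM2l.
Qed.

Lemma kappa_ge0 : 0 <= kappa.
Proof.
have [_ [_ lam0] _ _ _] := noiseB.
apply: divr_ge0; last exact: ltW.
by apply: addr_ge0; [|apply: mulr_ge0]; exact: sqr_ge0.
Qed.

Lemma lyapunov_weight : a * eta ^+ 2 = 8 + 8 * kappa.
Proof. by have [e0 _ _] := eta_hat_bounds; rewrite /a mulfVK// expf_neq0// gt_eqF. Qed.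

Lemma lyapunov_weight_ge0 : 0 <= a.
Proof.
by rewrite /a divr_ge0 ?sqr_ge0// addr_ge0// mulr_ge0// kappa_ge0.
Qed.

(** The constant is (4 + a eta^2) * (3 / 2) with a eta^2 = 8 + 8 kappa. *)
Lemma saddle_drift s :
  (\int[P]_w (lyapunov a (state_step Jm Sm eta (saddle (sB (xi w)))
                            (saddle_noise (xi w)) s))%:E
    <= (lyapunov a s + (18 + 12 * kappa) * sigg ^+ 2)%:E)%E.
Proof.
have [e0 er eB] := eta_hat_bounds.
have [_ [_ lam0] _ _ _] := noiseB.
have [_ _ _ _ indep] := noiseg.
have [mB mgx mgy] := measurable_sample xi.
have mg := measurable_fun_pair mgx mgy.
have [H [h0 hH Hle]] := stacked_noise_means noiseg.
have ms (TT := ('M[R]_n * ('cV[R]_n * 'cV[R]_n))%type) : measurable_fun setT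
    (fun u : TT => lyapunov a (state_step Jm Sm eta (saddle u.1)
                                 (col_mx u.2.1 (- u.2.2)) s)).
  apply: measurable_lyapunov; apply: measurable_state_step.
  - by apply: measurable_saddle; exact: measurable_fst.
  - apply: measurable_saddle_noise.
      exact: (measurableT_comp measurable_fst measurable_snd).
    exact: (measurableT_comp measurable_snd measurable_snd).
  - exact: measurable_cst.
have -> : (\int[P]_w (lyapunov a (state_step Jm Sm eta (saddle (sB (xi w)))
        (saddle_noise (xi w)) s))%:E =
    \int[P]_w \int[P]_w' (lyapunov a (state_step Jm Sm eta (saddle (Bxi xi w))
        (saddle_noise (xi w')) s))%:E)%E.
  apply: (@ge0_integral_indep R _ _ P _ _ P _ _ _ _ (Bxi xi)
    (fun w => (gxxi xi w, gyxi xi w)) (fun w => (gxxi xi w, gyxi xi w))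
    (fun u => (lyapunov a (state_step Jm Sm eta (saddle u.1)
                             (col_mx u.2.1 (- u.2.2)) s))%:E)) => //.
    exact/measurable_EFinP.
  by move=> u; rewrite lee_fin lyapunov_ge0// lyapunov_weight_ge0.
case: s {ms} => [[z b] c].
have aE := lyapunov_weight.
have := lyapunov_drift (measurable_saddle mB) (fun w => saddle_skew (Bxi xi w))
  (saddle_mean noiseB) (saddle_gram_mean noiseB) (saddle_sqr_mean noiseB)
  (saddle_var_mean noiseB) (saddle_gram_var_mean noiseB)
  (saddle_var_le noiseB) (saddle_gram_var_le noiseB) (stacked_sqr_mean_le noiseB)
  (stacked_gram_mean_ge noiseB) h0 hH Hle (rho_gt0 noiseB) er
  z b c lyapunov_weight_ge0.
rewrite aE => drift; apply: le_trans (drift _) _.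
  have -> : (8 + 8 * kappa) * lambda_min_M xi =
      8 * lambda_min_M xi + 8 * (sigB ^+ 2 + eta ^+ 2 * sigB2 ^+ 2).
    by rewrite /kappa /kappa_zeta -/eta; field; rewrite gt_eqF.
  by rewrite lerDr mulr_ge0// ltW.
by rewrite lee_fin le_eqVlt; apply/orP; left; apply/eqP; field.
Qed.

Lemma saddle_lower_bound v : (1 - alpha) * mu * dot v v <=
  dot ((Jm + eta *: Sm) *m v) ((Jm + eta *: Sm) *m v).
Proof.
have [e0 er eB] := eta_hat_bounds.
have [mu0 _ geT ge] := gram_bounds (dim_gt0 noiseB) B_nonsingular.
apply: (mean_field_lower_bound (fun w => saddle_skew (Bxi xi w))
  (saddle_mean noiseB) (saddle_gram_mean noiseB) (saddle_var_mean noiseB)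
  (saddle_var_le noiseB) e0 mu0 _ _ eB alpha_lt1).
  apply: forall_col_mx => x y.
  rewrite /saddle mul_block_col !mul0mx add0r addr0 !dot_col mulNmx dotNl dotNr opprK.
  by rewrite mulrDr addrC lerD.
exact: sqr_ge0.
Qed.

End saddle_dynamics.

Lemma sum_col_mx (R : realType) (I : Type) (r : seq I) m1 m2 n
    (f : I -> 'M[R]_(m1, n)) (g : I -> 'M[R]_(m2, n)) :
  \sum_(i <- r) col_mx (f i) (g i) = col_mx (\sum_(i <- r) f i) (\sum_(i <- r) g i).
Proof.
elim: r => [|i r IH]; first by rewrite !big_nil col_mx0.
by rewrite !big_cons IH add_col_mx.
Qed.

Theorem theorem3p1 (R : realType) (n : nat)
    (d0 : measure_display) (T0 : measurableType d0) (P0 : probability T0 R)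
    (xi : {RV P0 >-> sample R n n})
    (d : measure_display) (T : measurableType d) (P : probability T R)
    (Z : nat -> {RV P >-> sample R n n})
    (x0 y0 : 'cV[R]_n) (sigB sigB2 sigg alpha : R)
    (Z_iid : iid_copies xi (fun t : nat => Z t.+1))
    (noiseB : bilinear_noise xi sigB sigB2)
    (noiseg : intercept_noise xi sigg)
    (B_nonsingular : Bmean xi \in unitmx)
    (alpha_gt0 : 0 < alpha) (alpha_lt1 : alpha < 1)
    (K : nat) (K_ge1 : (1 <= K)%N) :
  let eta := eta_hat xi sigB alpha in
  let xbar w := seg_avg_x eta x0 y0 (fun t => Z t w) K in
  let ybar w := seg_avg_y eta x0 y0 (fun t => Z t w) K in
  ('E_P[fun w => (enorm (xbar w) ^+ 2 + enorm (ybar w) ^+ 2)%R]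
   <= (tau1 xi sigB sigB2 alpha
         * ((enorm x0 ^+ 2 + enorm y0 ^+ 2) / K.+1%:R ^+ 2)
       + tau2 xi sigB sigB2 alpha * (sigg ^+ 2 / K.+1%:R))%R%:E)%E.
Proof.
cbv zeta; set eta := eta_hat xi sigB alpha.
pose mu := lambda_min (Bmean xi *m (Bmean xi)^T).
pose kappa := kappa_zeta xi sigB sigB2 alpha.
pose a := (8 + 8 * kappa) / eta ^+ 2.
pose Jm := saddle (Bmean xi); pose Sm := stacked_gram_mean xi.
pose z0 := col_mx x0 y0.
have [e0 er eB] := eta_hat_bounds noiseB B_nonsingular alpha_gt0.
have [mu0 _ _ _] := gram_bounds (dim_gt0 noiseB) B_nonsingular.
have k0 : 0 <= kappa := kappa_ge0 alpha noiseB.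
have a0 : 0 <= a := lyapunov_weight_ge0 alpha noiseB.
have aE : a * eta ^+ 2 = 8 + 8 * kappa := lyapunov_weight noiseB B_nonsingular alpha_gt0.
pose F (u : 'cV[R]_(n + n) * 'cV[R]_(n + n) * 'cV[R]_(n + n) * sample R n n) :=
  state_step Jm Sm eta (saddle (sB u.2)) (saddle_noise u.2) u.1.
pose w0 : 'cV[R]_(n + n) * 'cV[R]_(n + n) * 'cV[R]_(n + n) := (z0, 0, 0).
pose X t : {RV P >-> sample R n n} := Z t.+1.
have mF : measurable_fun setT F.
  apply: measurable_state_step => //.
  - apply: measurable_saddle.
    exact: (measurableT_comp measurable_fst (measurableT_comp measurable_fst measurable_snd)).
  - apply: measurable_saddle_noise.
      exact: (measurableT_comp measurable_snd (measurableT_comp measurable_fst measurable_snd)).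
    exact: (measurableT_comp measurable_snd measurable_snd).
pose st t w := chain X F w0 t w.
have segE w t : col_mx (seg eta x0 y0 (fun t => Z t w) t).1
    (seg eta x0 y0 (fun t => Z t w) t).2 = (st t w).1.1.
  elim: t => [//|t IH]; rewrite /st /= -/(st t w) /F /=.
  move: IH; case: (st t w) => [[z b] c] /= <-.
  by case: (seg _ _ _ _ t) => x y; rewrite seg_step_skew.
pose c0 := (1 - alpha) * mu.
have c0p : 0 < c0 by rewrite mulr_gt0// subr_gt0.
pose D := K.+1%:R : R.
have D0 : 0 < D by rewrite ltr0Sn.
pose sum w := \sum_(0 <= t < K.+1) (st t w).1.1.
have avgE w : enorm (seg_avg_x eta x0 y0 (fun t => Z t w) K) ^+ 2 +
    enorm (seg_avg_y eta x0 y0 (fun t => Z t w) K) ^+ 2 =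
    (D ^+ 2)^-1 * dot (sum w) (sum w).
  rewrite /sum; under eq_bigr do rewrite -segE.
  rewrite sum_col_mx dot_col /seg_avg_x /seg_avg_y !enormE -/D.
  by rewrite !dotZl !dotZr; field; rewrite gt_eqF.
pose V w := lyapunov a (st K.+1 w).
pose bias := 8 / eta ^+ 2 * dot z0 z0.
pose k := (D ^+ 2)^-1 * c0^-1.
have k0' : 0 <= k by rewrite mulr_ge0 ?invr_ge0 ?sqr_ge0// ltW.
have bias0 : 0 <= bias by rewrite mulr_ge0 ?dot_ge0// divr_ge0 ?sqr_ge0.
have sum_le w : (D ^+ 2)^-1 * dot (sum w) (sum w) <= k * (V w + bias).
  rewrite /k -mulrA ler_wpM2l ?invr_ge0 ?sqr_ge0// mulrC ler_pdivlMr// mulrC.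
  apply: (@sum_le_lyapunov R (n + n) Jm Sm eta
    (fun t => saddle (sB (X t w))) (fun t => saddle_noise (X t w))
    (fun t => st t w) z0 _ _ _ a c0 K.+1 e0) => //.
  - by move=> t; exact: saddle_skew.
  - by rewrite aE lerDl mulr_ge0.
  - exact: saddle_lower_bound noiseB B_nonsingular alpha_gt0 alpha_lt1.
have mst t : measurable_fun setT (st t) by exact: measurable_chain.
have msum : measurable_fun setT sum.
  apply: measurable_mx_sum => t.
  exact: (measurableT_comp measurable_fst (measurableT_comp measurable_fst (mst t))).
have mV : measurable_fun setT V by exact: measurable_lyapunov.
have V0 w : 0 <= V w by exact: lyapunov_ge0.
rewrite unlock; under eq_integral do rewrite avgE.
apply: (@le_trans _ _ (\int[P]_w (k%:E * ((V w)%:E + bias%:E)))%E).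
  apply: ge0_le_integral => //.
  - by move=> w _; rewrite lee_fin mulr_ge0 ?invr_ge0 ?sqr_ge0 ?dot_ge0.
  - apply/measurable_EFinP; apply: measurable_funM => //; exact: measurable_dot.
  - apply: measurable_funeM; apply: emeasurable_funD => //; exact/measurable_EFinP.
  - by move=> w _; rewrite lee_fin; exact: sum_le.
rewrite ge0_integralZl//; last 2 first.
- by apply: emeasurable_funD => //; exact/measurable_EFinP.
- by move=> w _; rewrite adde_ge0// lee_fin.
rewrite ge0_integralD//; [|by move=> w _; rewrite lee_fin|exact/measurable_EFinP].
rewrite integral_cst//= probability_setT mule1.
have drift := @chain_drift R _ T P _ _ P0 _ _ _ _ xi X Z_iid F w0 mF (lyapunov a)
  ((18 + 12 * kappa) * sigg ^+ 2) K.+1.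
apply: (@le_trans _ _ (k%:E *
    ((lyapunov a w0 + (18 + 12 * kappa) * sigg ^+ 2 * D)%:E + bias%:E))%E).
  apply: lee_wpmul2l; first by rewrite lee_fin.
  apply: leeD2r; apply: drift.
  - apply: measurable_lyapunov; exact: measurable_id.
  - by move=> w; exact: lyapunov_ge0.
  - by rewrite mulr_ge0 ?sqr_ge0// addr_ge0// mulr_ge0.
  - by move=> w; exact: saddle_drift noiseB noiseg B_nonsingular alpha_gt0 w.
rewrite -EFinD -EFinM lee_fin le_eqVlt; apply/orP; left; apply/eqP.
have z0E : enorm x0 ^+ 2 + enorm y0 ^+ 2 = dot z0 z0 by rewrite dot_col !enormE.
rewrite z0E /tau1 /tau2 -/eta -/kappa -/mu -/D /lyapunov /w0 /= !dot0r /k /bias /a /c0.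
by field; rewrite !gt_eqF// subr_gt0.
Qed.
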